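(* Let $\alpha\in(0,1)$, $\gamma,\varepsilon,T>0$, let $u_0\in H^2(\Omega)\cap H_0^1(\Omega)$, and let $u$ be the solution on $(0,T)\times\Omega$ of the time-fractional Allen--Cahn problem $\partial_t^\alpha u=\gamma(\varepsilon^2\Delta u-f(u))$, $u(0,\cdot)=u_0$, with homogeneous Dirichlet boundary condition, where $f(u)=u^3-u$. Define $$E(t)=\int_\Omega\Big(\frac{\varepsilon^2}{2}|\nabla u(t)|^2+\frac14(u(t)^2-1)^2\Big)dx,\qquad \tilde E(t)=E(t)+\frac{1}{\gamma\Gamma(1-\alpha)}D_\alpha(t),$$ where $$D_\alpha(t)=\frac{\|u(t)-u(0)\|^2}{2t^\alpha}+\frac{\alpha}{2}\int_0^t\frac{\|u(t)-u(\tau)\|^2}{(t-\tau)^{\alpha+1}}\,d\tau .$$ Then $$E(t)\le\tilde E(t)\le\tilde E(s)\le E(0)\qquad\text{for all }0\le s\le t\le T.$$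
   Context: $\Omega\subset\mathbb{R}^d$ is a bounded domain with sufficiently regular boundary; $\|\cdot\|$ is the norm of $L^2(\Omega)$; $u(t)=u(t,\cdot)$. The value $D_\alpha(0)$ (hence $\tilde E(0)$) is understood as the limit for $t\to0^+$. The Caputo derivative of order $\alpha\in(0,1)$ is $\partial_t^\alpha u(t)=\frac{1}{\Gamma(1-\alpha)}\int_0^t\frac{\partial_\tau u(\tau)}{(t-\tau)^\alpha}\,d\tau$, $t>0$. For $u_0\in H^2(\Omega)\cap H_0^1(\Omega)$ and $T>0$ the solution of the Dirichlet problem is the unique solution with the following (known) regularity: $u\in H^\alpha(0,T;L^2(\Omega))\cap L^2(0,T;H^2(\Omega)\cap H_0^1(\Omega))$, $u\in L^\infty((0,T)\times\Omega)$, $u\in C^\alpha([0,T];L^2(\Omega))\cap C([0,T];H^2(\Omega)\cap H_0^1(\Omega))$, $\partial_t^\alpha u\in C([0,T];L^2(\Omega))$, $\partial_t u\in C((0,T];L^2(\Omega))$, and $\|\partial_t u(t)\|\le Ct^{\alpha-1}$ for $t\in(0,T]$, with a constant $C$ depending on $u_0$ and $T$. *)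

(* Defs.v *)
From HB Require Import structures.
From mathcomp Require Import all_boot all_order all_algebra.
From mathcomp Require Import all_classical all_reals all_analysis.

Set Implicit Arguments.
Unset Strict Implicit.
Unset Printing Implicit Defensive.
Import Order.TTheory GRing.Theory Num.Theory.
Import numFieldNormedType.Exports.
Local Open Scope classical_set_scope.
Local Open Scope ring_scope.

(* Row vectors carry the sigma-algebra generated by the coordinates, which over
   the reals is the Borel sigma-algebra of 'rV[R]_n. *)
Definition measure_rV_display : measure_display -> measure_display.
Proof. exact. Qed.

Section measurable_rV.
Context {disp : measure_display} {T : sigmaRingType disp}.
Variable n : nat.

Let coors : 'I_n -> 'rV[T]_n -> T := fun i v => v ord0 i.

Let rV_set0 : g_sigma_preimage coors set0.
Proof. exact: sigma_algebra0. Qed.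

Let rV_setC A : g_sigma_preimage coors A -> g_sigma_preimage coors (~` A).
Proof. exact: sigma_algebraC. Qed.

Let rV_bigcup (F : _^nat) : (forall i, g_sigma_preimage coors (F i)) ->
  g_sigma_preimage coors (\bigcup_i (F i)).
Proof. exact: sigma_algebra_bigcup. Qed.

HB.instance Definition _ := @isMeasurable.Build (measure_rV_display disp)
  'rV[T]_n (g_sigma_preimage coors) rV_set0 rV_setC rV_bigcup.

End measurable_rV.

Lemma measurable_coord_rV (disp : measure_display) (T : sigmaRingType disp)
    (n : nat) (i : 'I_n) :
  measurable_fun [set: 'rV[T]_n] (fun v : 'rV[T]_n => v ord0 i).
Proof.
move=> _ Y mY; rewrite setTI; apply: sub_sigma_algebra => /=.
rewrite -bigcup_seq/=; exists i => /=; first by rewrite mem_index_enum.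
by exists Y => //; rewrite setTI.
Qed.

Lemma measurable_fun_rVP (d1 d2 : measure_display) (T1 : measurableType d1)
    (T2 : measurableType d2) (n : nat) (f : T1 -> 'rV[T2]_n) :
  (forall i, measurable_fun [set: T1] (fun x => f x ord0 i)) ->
  measurable_fun [set: T1] f.
Proof.
move=> mf.
suff : g_sigma_preimage (fun i x => f x ord0 i) `<=` measurable.
  rewrite (_ : (fun i x => f x ord0 i) =
               (fun i => (fun v : 'rV[T2]_n => v ord0 i) \o f))//.
  rewrite g_sigma_preimage_comp => prefS _ A mA.
  by apply: prefS; exists A.
apply: smallest_sub; first exact: sigma_algebra_measurable.
move=> A; rewrite -bigcup_seq/= => -[i _ [B mB <-]]; exact: mf.
Qed.

Section lebesgue_rV.
Context {R : realType}.

Definition cons_rV n (p : measurableTypeR R * 'rV[R]_n) : 'rV[R]_n.+1 :=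
  row_mx (const_mx p.1 : 'rV[R]_1) p.2.

Lemma cons_rV0 n (p : measurableTypeR R * 'rV[R]_n) :
  cons_rV p ord0 ord0 = p.1.
Proof.
rewrite /cons_rV mxE; case: (@split_ordP 1 n ord0) => j /(congr1 val)//= _.
by rewrite mxE.
Qed.

Lemma cons_rVS n (p : measurableTypeR R * 'rV[R]_n) (i : 'I_n) :
  cons_rV p ord0 (lift ord0 i) = p.2 ord0 i.
Proof.
rewrite /cons_rV mxE; case: split_ordP => j /(congr1 val)/= E.
  by move: (ltn_ord j); rewrite -E.
by congr (p.2 _ _); apply: val_inj; case: E.
Qed.

Lemma measurable_cons_rV n : measurable_fun [set: _] (@cons_rV n).
Proof.
apply: (@measurable_fun_rVP _ _ _ (measurableTypeR R)) => i.
case: (unliftP ord0 i) => [j ->|->].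
  rewrite [X in measurable_fun _ X](_ : _ = (fun v : 'rV[R]_n => v ord0 j) \o snd).
    exact: (measurableT_comp (@measurable_coord_rV _ (measurableTypeR R) n j)).
  by apply/funext => p /=; exact: cons_rVS.
rewrite [X in measurable_fun _ X](_ : _ = fst) ?measurable_fst//.
by apply/funext => p; exact: cons_rV0.
Qed.

Lemma measurable_rsubmx n :
  measurable_fun [set: 'rV[R]_n.+1] (fun v => rsubmx (v : 'rV[R]_(1 + n))).
Proof.
apply: (@measurable_fun_rVP _ _ _ (measurableTypeR R)) => i.
rewrite [X in measurable_fun _ X](_ : _ =
  fun v : 'rV[R]_n.+1 => v ord0 (rshift 1 i)).
  exact: (@measurable_coord_rV _ (measurableTypeR R)).
by apply/funext => v; rewrite mxE.
Qed.

Section step.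
Variables (n : nat) (m : {sigma_finite_measure set 'rV[R]_n -> \bar R}).

Definition lebesgue_cons : set 'rV[R]_n.+1 -> \bar R :=
  pushforward (@lebesgue_measure R \x m)%E (@cons_rV n).

Let lebesgue_cons0 : lebesgue_cons set0 = 0%E.
Proof. by rewrite /lebesgue_cons /pushforward preimage_set0 measure0. Qed.

Let lebesgue_cons_ge0 A : (0 <= lebesgue_cons A)%E.
Proof.
by rewrite /lebesgue_cons /pushforward; exact: measure_ge0.
Qed.

Let measurable_preimage_cons (A : set 'rV[R]_n.+1) :
  measurable A -> measurable (@cons_rV n @^-1` A).
Proof.
by move=> mA; rewrite -[X in measurable X]setTI; exact: measurable_cons_rV.
Qed.

Let lebesgue_cons_sigma_additive : semi_sigma_additive lebesgue_cons.
Proof.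
move=> F mF tF mUF; rewrite /lebesgue_cons /pushforward preimage_bigcup.
apply: measure_semi_sigma_additive.
- by move=> k; exact: measurable_preimage_cons.
- apply/trivIsetP => /= i j _ _ ij; rewrite -preimage_setI.
  by move/trivIsetP : tF => /(_ _ _ _ _ ij) ->//; rewrite preimage_set0.
- by rewrite -preimage_bigcup; exact: measurable_preimage_cons.
Qed.

HB.instance Definition _ := isMeasure.Build _ _ _ lebesgue_cons
  lebesgue_cons0 lebesgue_cons_ge0 lebesgue_cons_sigma_additive.

Let lebesgue_cons_sigma_finite : sigma_finite setT lebesgue_cons.
Proof.
have /sigma_finiteP[F [TF ndF Foo]] := sigma_finiteT (@lebesgue_measure R).
have /sigma_finiteP[G [TG ndG Goo]] := sigma_finiteT m.
pose h (v : 'rV[R]_n.+1) : measurableTypeR R * 'rV[R]_n :=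
  (v ord0 ord0, rsubmx (v : 'rV[R]_(1 + n))).
have hK : cancel (@cons_rV n) h.
  move=> p; rewrite /h cons_rV0 /cons_rV row_mxKr; exact/esym/surjective_pairing.
have mh : measurable_fun [set: _] h.
  apply/measurable_fun_pairP; split.
    exact: (@measurable_coord_rV _ (measurableTypeR R)).
  exact: measurable_rsubmx.
exists (fun k => h @^-1` (F k `*` G k)).
  rewrite -preimage_bigcup -(preimage_setT h); congr (_ @^-1` _).
  rewrite -setXTT TF TG predeqE => -[x y]; split.
    move=> [/= [i _ Fix] [j _ Gjy]]; exists (maxn i j) => //; split.
    - by move: x Fix; exact/subsetPset/ndF/leq_maxl.
    - by move: y Gjy; exact/subsetPset/ndG/leq_maxr.
  by move=> [i _ []/= ? ?]; split; exists i.
move=> k; have [mF Foo_k] := Foo k; have [mG Goo_k] := Goo k; split.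
  by rewrite -[X in measurable X]setTI; apply: mh => //; exact: measurableX.
rewrite /lebesgue_cons /pushforward -comp_preimage.
rewrite (_ : h \o _ = id) ?preimage_id; last by apply/funext => x; exact: hK.
by rewrite product_measure1E// lte_mul_pinfty// ge0_fin_numE.
Qed.

HB.instance Definition _ := Measure_isSigmaFinite.Build _ _ _ lebesgue_cons
  lebesgue_cons_sigma_finite.
End step.

(* n-dimensional Lebesgue measure, as an iterated product; lebesgue_rV_box
   computes it on boxes. *)
Fixpoint lebesgue_rV n : {sigma_finite_measure set 'rV[R]_n -> \bar R} :=
  match n with
  | 0%N => @dirac _ 'rV[R]_0 0 R
  | k.+1 => lebesgue_cons (lebesgue_rV k)
  end.

Lemma lebesgue_rV_box n (A : 'I_n -> set R) : (forall i, measurable (A i)) ->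
  lebesgue_rV n [set v | forall i, A i (v ord0 i)] =
  (\prod_(i < n) lebesgue_measure (A i))%E.
Proof.
elim: n A => [|n ih] A mA.
  by rewrite big_ord0 /= diracE mem_set//= => -[].
rewrite big_ord_recl -ih//= /lebesgue_cons /pushforward.
rewrite -product_measure1E//; last first.
  rewrite [X in measurable X](_ : _ =
      \bigcap_(i in [set: 'I_n]) ((fun v : 'rV[R]_n => v ord0 i) @^-1`
                               A (lift ord0 i))).
    apply: fin_bigcap_measurable => // i _.
    have := @measurable_coord_rV _ R n i measurableT _ (mA (lift ord0 i)).
    by rewrite setTI.
  by apply/seteqP; split => v /= Av i; move: (Av i) => // /(_ Logic.I).
  exact: mA.
congr (product_measure1 _ _ _); apply/seteqP; split => -[x w] /= Axw.
  split => [|i]; first by have := Axw ord0; rewrite cons_rV0.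
  by have := Axw (lift ord0 i); rewrite cons_rVS.
by move=> i; case: (unliftP ord0 i) => [j ->|->];
  rewrite ?cons_rVS ?cons_rV0; [exact: Axw.2|exact: Axw.1].
Qed.

End lebesgue_rV.

Section domains.
Context {R : realType} {d : nat}.
Local Notation X := 'rV[R]_d.
Implicit Types (Omega : set X).

Definition dotv (v w : X) : R := \sum_(i < d) v ord0 i * w ord0 i.

Definition bounded_domain Omega : Prop :=
  [/\ Omega !=set0, open Omega, connected Omega & bounded_set Omega].

(* Near each boundary point p, Omega is, for some unit vector e, the strict
   epigraph in direction e of a Lipschitz function of the orthogonal
   projection on the complement of e. *)
Definition lipschitz_boundary Omega : Prop :=
  forall p : X, (closure Omega `\` interior Omega) p ->
  exists (e : X) (r : R) (g : X -> R),
    [/\ dotv e e = 1, 0 < r, [lipschitz g x | x in [set: X]] &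
        forall x, ball p r x ->
          (Omega x <-> g (x - dotv x e *: e) < dotv x e)].

End domains.

Section sobolev.
Context {R : realType} {d : nat} (Omega : set 'rV[R]_d).
Local Notation X := 'rV[R]_d.
Local Notation vol := (lebesgue_rV (R := R) d).
Implicit Types (f g phi : X -> R) (i j : 'I_d).

(* Elements of L^2(Omega) are represented by functions on the whole space, of
   which only the values on Omega matter. *)
Definition L2 : set (X -> R) := [set f | f \_ Omega \in Lfun vol 2%:E].

Definition L2norm f : R := fine ('N[vol]_2%:E [EFin \o f \_ Omega])%E.

Definition L2dist f g : R := L2norm (f \- g).

Definition partial i f : X -> R := 'D_(delta_mx ord0 i) f.

Fixpoint Ck k f : Prop :=
  match k with
  | 0%N => continuous f
  | m.+1 => continuous f /\
      forall i, (forall x, derivable f x (delta_mx ord0 i)) /\ Ck m (partial i f)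
  end.

Definition test_function phi : Prop :=
  [/\ forall k, Ck k phi, compact (closure [set x | phi x != 0]) &
      closure [set x | phi x != 0] `<=` Omega].

Definition weak_partial i f g : Prop :=
  forall phi, test_function phi ->
    \int[vol]_(x in Omega) (f x * partial i phi x) =
    - \int[vol]_(x in Omega) (g x * phi x).

(* A representative of the weak derivative of f in L^2(Omega), if there is
   one. *)
Definition wpartial i f : X -> R :=
  xget (cst 0) [set g | L2 g /\ weak_partial i f g].

Definition H1 : set (X -> R) :=
  [set f | L2 f /\ forall i, exists g, L2 g /\ weak_partial i f g].

Definition H2 : set (X -> R) := [set f | H1 f /\ forall i, H1 (wpartial i f)].

(* The closure of the test functions for the norm of H^1(Omega). *)
Definition H10 : set (X -> R) :=
  [set f | H1 f /\ exists phi : nat -> X -> R,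
    [/\ forall n, test_function (phi n),
        L2dist (phi n) f @[n --> \oo] --> (0 : R) &
        forall i, L2dist (partial i (phi n)) (wpartial i f)
                    @[n --> \oo] --> (0 : R)]].

Definition H2_H10 : set (X -> R) := H2 `&` H10.

(* By linearity of weak derivatives, this is the norm of f - g in
   H^2(Omega). *)
Definition H2dist f g : R := Num.sqrt (L2dist f g ^+ 2 +
  \sum_(i < d) L2dist (wpartial i f) (wpartial i g) ^+ 2 +
  \sum_(i < d) \sum_(j < d)
    L2dist (wpartial j (wpartial i f)) (wpartial j (wpartial i g)) ^+ 2).

Definition laplacian f : X -> R :=
  fun x => \sum_(i < d) wpartial i (wpartial i f) x.

End sobolev.

(* Functions of time with values in a space V of functions of x, metrized by
   dist; intervals of time are given as sets of reals. *)
Section vector_valued.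
Context {R : realType} {d : nat}.
Local Notation X := 'rV[R]_d.
Local Notation leb := (@lebesgue_measure R).
Implicit Types (V : set (X -> R)) (dist : (X -> R) -> (X -> R) -> R).
Implicit Types (D : set R) (u v : R -> X -> R).

Definition continuous_in V dist D u : Prop :=
  forall t, D t -> V (u t) /\
    dist (u s) (u t) @[s --> within D (nbhs t)] --> (0 : R).

(* The list of the (A_k, v_k) encodes the simple function that maps t to the
   sum of the 1_(A_k)(t) v_k. *)
Definition simple_in V D (s : seq (set R * (X -> R))) : Prop :=
  forall p, p \in s ->
    [/\ measurable p.1, (leb (p.1 `&` D) < +oo)%E & V p.2].

Definition simple_val (s : seq (set R * (X -> R))) : R -> X -> R :=
  fun t x => \sum_(p <- s) \1_(p.1) t * p.2 x.

Definition simple_int D (s : seq (set R * (X -> R))) : X -> R :=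
  fun x => \sum_(p <- s) fine (leb (p.1 `&` D)) * p.2 x.

Definition strongly_measurable V dist D u : Prop :=
  exists s : nat -> seq (set R * (X -> R)),
    (forall n, simple_in V D (s n)) /\
    {ae leb, forall t, D t ->
      V (u t) /\ dist (u t) (simple_val (s n) t) @[n --> \oo] --> (0 : R)}.

Definition L2_in_time V dist D u : Prop :=
  strongly_measurable V dist D u /\
  (\int[leb]_(t in D) (dist (u t) (cst 0) ^+ 2)%:E < +oo)%E.

Definition is_bochner_integral V dist D u (J : X -> R) : Prop :=
  V J /\ exists s : nat -> seq (set R * (X -> R)),
    [/\ forall n, simple_in V D (s n),
        forall n, measurable_fun D (fun t => dist (u t) (simple_val (s n) t)),
        (\int[leb]_(t in D) (dist (u t) (simple_val (s n) t))%:E)%E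
          @[n --> \oo] --> 0%E &
        dist (simple_int D (s n)) J @[n --> \oo] --> (0 : R)].

End vector_valued.

Section time_fractional.
Context {R : realType} {d : nat} (Omega : set 'rV[R]_d).
Local Notation X := 'rV[R]_d.
Local Notation leb := (@lebesgue_measure R).
Local Notation vol := (lebesgue_rV (R := R) d).
Local Notation L2 := (L2 Omega).
Local Notation L2norm := (L2norm Omega).
Local Notation L2dist := (L2dist Omega).
Implicit Types (alpha gamma eps T t : R) (u v : R -> X -> R).

Definition Gamma (z : R) : R :=
  \int[leb]_(t in `]0, +oo[) (t `^ (z - 1) * expR (- t)).

(* v is the derivative of u at t, relatively to the set of times D, for the
   norm of L^2(Omega). *)
Definition is_time_derivative (D : set R) u t (v : X -> R) : Prop :=
  L2 v /\ L2dist (fun x => (u s x - u t x) / (s - t)) v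
            @[s --> within (D `\ t) (nbhs t)] --> (0 : R).

(* w is the Caputo derivative of order alpha at time t of a function whose time
   derivative is ut. *)
Definition is_caputo alpha (ut : R -> X -> R) t (w : X -> R) : Prop :=
  exists J, is_bochner_integral L2 L2dist `]0, t[
      (fun tau x => ut tau x / (t - tau) `^ alpha) J /\
    w = (fun x => (Gamma (1 - alpha))^-1 * J x).

(* The fractional Sobolev space H^alpha(0, T; L^2(Omega)). *)
Definition Halpha_in_time alpha T u : Prop :=
  L2_in_time L2 L2dist `]0, T[ u /\
  (\int[leb]_(t in `]0%R, T[) \int[leb]_(s in `]0%R, T[)
     (L2dist (u t) (u s) ^+ 2 / `|t - s| `^ (1 + 2 * alpha))%:E < +oo)%E.

Definition Calpha_in_time alpha T u : Prop :=
  (forall t, 0 <= t <= T -> L2 (u t)) /\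
  exists C : R, forall s t, 0 <= s <= T -> 0 <= t <= T ->
    L2dist (u t) (u s) <= C * `|t - s| `^ alpha.

(* u is essentially bounded on (0, T) x Omega. *)
Definition Linfty_space_time T u : Prop :=
  measurable_fun (`]0, T[ `*` Omega : set (measurableTypeR R * X)%type)
    (fun p => u p.1 p.2) /\
  exists M : R, {ae (leb \x vol)%E, forall p : (measurableTypeR R * X)%type,
    0 < p.1 < T -> Omega p.2 -> `|u p.1 p.2| <= M}.

Definition ac_f (r : R) : R := r ^+ 3 - r.

(* u solves the problem, with time derivative ut and Caputo derivative cu of
   order alpha; the value of cu at 0 is the one given by continuity. The
   boundary condition is expressed by the membership of u t in H^1_0. *)
Record allen_cahn_solution alpha gamma eps T (u0 : X -> R)
    (u ut cu : R -> X -> R) : Prop := {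
  acs_time_derivative :
    forall t, 0 < t <= T -> is_time_derivative `[0, T] u t (ut t) ;
  acs_caputo : forall t, 0 < t <= T -> is_caputo alpha ut t (cu t) ;
  acs_equation : forall t, 0 < t < T ->
    {ae vol, forall x, Omega x ->
      cu t x = gamma * (eps ^+ 2 * laplacian Omega (u t) x - ac_f (u t x))} ;
  acs_initial : {ae vol, forall x, Omega x -> u 0 x = u0 x} ;
  acs_Halpha : Halpha_in_time alpha T u ;
  acs_L2_H2 : L2_in_time (H2_H10 Omega) (H2dist Omega) `]0, T[ u ;
  acs_Linfty : Linfty_space_time T u ;
  acs_Calpha : Calpha_in_time alpha T u ;
  acs_C_H2 : continuous_in (H2_H10 Omega) (H2dist Omega) `[0, T] u ;
  acs_C_caputo : continuous_in L2 L2dist `[0, T] cu ;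
  acs_C_time_derivative : continuous_in L2 L2dist `]0, T] ut ;
  acs_time_derivative_bound : exists C : R, forall t, 0 < t <= T ->
    L2norm (ut t) <= C * t `^ (alpha - 1)
}.

Definition energy eps u t : R :=
  \int[vol]_(x in Omega)
    (eps ^+ 2 / 2 * (\sum_(i < d) wpartial Omega i (u t) x ^+ 2) +
     4^-1 * (u t x ^+ 2 - 1) ^+ 2).

Definition history_pos alpha u t : R :=
  L2norm (u t \- u 0) ^+ 2 / (2 * t `^ alpha) +
  alpha / 2 * \int[leb]_(tau in `]0, t[)
    (L2norm (u t \- u tau) ^+ 2 / (t - tau) `^ (alpha + 1)).

(* The function D_alpha on [0, +oo[: its value at 0 is the limit at 0+. *)
Definition history alpha u t : R :=
  if t == 0 then lim (history_pos alpha u s @[s --> 0^'+])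
  else history_pos alpha u t.

Definition modified_energy alpha gamma eps u t : R :=
  energy eps u t + (gamma * Gamma (1 - alpha))^-1 * history alpha u t.

End time_fractional.

(* Main.v *)
From HB Require Import structures.
Require Import Defs.
From mathcomp Require Import all_boot all_order all_algebra.
From mathcomp Require Import all_classical all_reals all_analysis.
From mathcomp Require Import measurable_realfun ring lra.

(** The problem is a gradient flow with memory. Write [J t], the memory force at time
    [t], for the integral over [`]0, t[] of [ut tau / (t - tau) `^ alpha], so that the
    Caputo derivative of [u] is [J t / Gamma (1 - alpha)], and [D] for the function
    [history_pos].

    If [u] is continued by [u 0] to negative times, then [D t] is [alpha / 2] times the
    integral over [l > 0] of [|u t - u (t - l)|^2 / l `^ (alpha + 1)], and [J t] is
    [alpha] times that of [(u t - u (t - l)) / l `^ (alpha + 1)]. Going from [t] to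
    [t + h], one expands the square of [u (t + h) - u x] around [u t - u x] and uses
    that the kernel decreases as the past recedes: up to [o(h)], the history increases
    by at most the product of [u (t + h) - u t] with [J t] ([history_step],
    [history_dini]). This one-sided bound stands in for the derivative of [D], whose
    computation would have to differentiate a singular integral. To recover [J], which
    is made of the derivative of [u], from the differences [u t - u x], one integrates
    by parts with the kernel shifted by [h], which is smooth up to time [t]
    ([memory_workE]), and then lets [h] tend to 0 by dominated convergence
    ([memory_work_limit]). The Bochner integral [J] enters only through its products
    with elements of L2 ([bochner_pairing]).

    The increment of the energy is, up to [o(h)], the product of [u (t + h) - u t] with
    [- (eps ^+ 2 * Lap (u t) - ac_f (u t))] ([energy_difference]). It comes from an
    integration by parts, where membership in H^1_0 is used through the approximation
    by test functions ([H10_by_parts]), and from a Taylor expansion of the double well,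
    for which [u t] has to be essentially bounded at every time, not just at almost
    every one ([Linfty_all_times]). By the equation this product is the opposite of
    [(gamma * Gamma (1 - alpha))^-1] times the product with [J t]. So the upper right
    derivative of the modified energy is nonpositive on the open interval
    ([modified_energy_dini]). As the modified energy does not jump upwards from the
    left either, it is nonincreasing ([nonincreasing_of_dini]).

    Finally, [0 <= D t <= C ^+ 2 * t `^ alpha] by Hoelder continuity: the modified
    energy dominates the energy, and it tends to the initial energy at 0. *)

Set Implicit Arguments.
Unset Strict Implicit.
Unset Printing Implicit Defensive.
Import Order.TTheory GRing.Theory Num.Theory.
Import numFieldNormedType.Exports.
Local Open Scope classical_set_scope.
Local Open Scope ring_scope.

(** * The fundamental theorem of calculus on an open interval *)

Section open_interval_FTC.
Context {R : realType}.
Local Notation leb := (@lebesgue_measure R).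
Variables (F f : R -> R) (a b : R).
Hypotheses (ab : a < b) (cF : {within `[a, b], continuous F})
  (dF : forall x, a < x < b -> is_derive x 1 F (f x))
  (cf : forall x, a < x < b -> {for x, continuous f}).

(* The factor 1/3 keeps I 0 from being degenerate. *)
Let c n : R := (b - a) / 3 * n.+1%:R^-1.
Let I n : set R := `[a + c n, b - c n].

Let c_gt0 n : 0 < c n.
Proof. by rewrite mulr_gt0 ?invr_gt0// divr_gt0 ?subr_gt0. Qed.

Let c_le n : c n <= (b - a) / 3.
Proof.
apply: ler_piMr; first by rewrite divr_ge0// subr_ge0 ltW.
by rewrite invf_le1 ?ltr0n// ler1n.
Qed.

Let c_noninc m n : (m <= n)%N -> c n <= c m.
Proof.
move=> mn; apply: ler_wpM2l; first by rewrite divr_ge0// subr_ge0 ltW.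
by rewrite lef_pV2 ?posrE// ler_nat.
Qed.

Let c_cvg0 : c n @[n --> \oo] --> (0 : R).
Proof.
rewrite -[X in _ --> X](mulr0 ((b - a) / 3)); apply: cvgMr.
exact: cvg_harmonic.
Qed.

Let I_sub n x : I n x -> a < x < b.
Proof.
rewrite /I/= in_itv/=; have := c_gt0 n; lra.
Qed.

Let I_lt n : a + c n < b - c n.
Proof. by have := c_le n; have := c_gt0 n; lra. Qed.

Let I_bigcup : \bigcup_n I n = `]a, b[%classic.
Proof.
apply/seteqP; split => x /=.
  by move=> [n _ /I_sub]; rewrite in_itv.
rewrite in_itv/= => /andP[ax xb].
have e0 : 0 < Num.min (x - a) (b - x) by rewrite lt_min; apply/andP; split; lra.
have /cvgrPdist_lt/(_ _ e0)[n _ /(_ n (leqnn n))] := c_cvg0.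
rewrite sub0r normrN gtr0_norm// lt_min => /andP[? ?].
by exists n => //; rewrite /I/= in_itv/=; apply/andP; split; lra.
Qed.

Let I_nondec : nondecreasing_seq I.
Proof.
move=> m n /c_noninc mn; rewrite subsetEset => x; rewrite /I/= !in_itv/=.
by move=> /andP[? ?]; apply/andP; split; lra.
Qed.

Let mI n : measurable (I n).
Proof. exact: measurable_itv. Qed.

Let cf_within (D : set R) : D `<=` `]a, b[ -> {within D, continuous f}.
Proof.
move=> DI; apply: continuous_in_subspaceT => x /set_mem/DI/=.
by rewrite in_itv => /cf.
Qed.

Let I_int n : (\int[leb]_(x in I n) (f x)%:E = (F (b - c n))%:E - (F (a + c n))%:E)%E.
Proof.
have H x : `[a + c n, b - c n]%classic x -> a < x < b by exact: I_sub.
apply: continuous_FTC2 => //.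
- by apply: cf_within => x /I_sub; rewrite /= in_itv.
- have c' x : a < x < b -> {for x, continuous F}.
    move=> /dF d; apply/differentiable_continuous/derivable1_diffP.
    exact: ex_derive.
  split.
  + move=> x xI; have xab : a < x < b by apply: H; exact: subset_itv_oo_cc.
    by have := dF xab => ?; exact: ex_derive.
  + apply: cvg_at_right_filter; apply: c'; apply: H => /=.
    by rewrite in_itv/= lexx ltW.
  + apply: cvg_at_left_filter; apply: c'; apply: H => /=.
    by rewrite in_itv/= lexx ltW.
- move=> x xI; have xab : a < x < b by apply: H; exact: subset_itv_oo_cc.
  by rewrite derive1E; have [_ ->] := dF xab.
Qed.

Let F_cvg : ((F (b - c n))%:E - (F (a + c n))%:E)%E @[n --> \oo] -->
  (F b - F a)%:E.
Proof.
apply: cvg_EFin; first exact: nearW.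
have [_ Fa Fb] := (continuous_within_itvP F ab).1 cF.
apply: cvgB.
  apply: (cvg_trans _ Fb) => /= A [e /= e0 Ae].
  have /cvgrPdist_lt/(_ _ e0)[n _ H] := c_cvg0.
  exists n => // m /H; rewrite sub0r normrN => ?; apply: Ae => /=.
    by rewrite opprD opprK addNKr// -opprB.
  by rewrite ltrBlDr ltrDl.
apply: (cvg_trans _ Fa) => /= A [e /= e0 Ae].
have /cvgrPdist_lt/(_ _ e0)[n _ H] := c_cvg0.
exists n => // m /H; rewrite sub0r normrN => ?; apply: Ae => /=.
  by rewrite opprD addNKr normrN.
by rewrite ltrDl.
Qed.

Let mf (D : set R) : measurable D -> D `<=` `]a, b[ -> measurable_fun D f.
Proof.
by move=> mD DI; apply: subspace_continuous_measurable_fun => //; exact: cf_within.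
Qed.

(** The compact intervals [I n] exhaust [`]a, b[]. For a nonnegative [f], monotone
    convergence makes integrability part of the conclusion, so that this also
    proves the convergence of improper integrals. *)
Lemma ge0_FTC_oo : (forall x, a < x < b -> 0 <= f x) ->
  (\int[leb]_(x in `]a, b[) (f x)%:E = (F b - F a)%:E)%E.
Proof.
move=> f0; have := F_cvg; under eq_fun do rewrite -I_int.
move/(cvg_unique (@ereal_hausdorff R)) => H; apply/esym/H; rewrite -I_bigcup.
apply: ge0_nondecreasing_set_cvg_integral => //.
- by move=> n; apply/measurable_EFinP; apply: mf => // x /I_sub; rewrite /= in_itv.
- by move=> n x /I_sub/f0; rewrite lee_fin.
Qed.

Lemma ge0_integrable_oo : (forall x, a < x < b -> 0 <= f x) ->
  leb.-integrable `]a, b[ (EFin \o f).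
Proof.
move=> f0; apply/integrableP; split; first by apply/measurable_EFinP; exact: mf.
under eq_integral => x.
  rewrite inE/= in_itv/= => xab; rewrite ger0_norm ?f0//; over.
by rewrite ge0_FTC_oo// ltry.
Qed.

(** The same exhaustion, by dominated convergence, for an integrand of any sign. *)
Lemma Rintegral_FTC_oo : leb.-integrable `]a, b[ (EFin \o f) ->
  \int[leb]_(x in `]a, b[) f x = F b - F a.
Proof.
move=> fi; apply/EFin_inj; rewrite fineK; last exact: integrable_fin_num.
have := F_cvg; under eq_fun do rewrite -I_int.
move/(cvg_unique (@ereal_hausdorff R)) => H; apply/esym/H => {H}.
have D n : (\int[leb]_(x in I n) (f x)%:E =
  \int[leb]_(x in `]a, b[) ((EFin \o f) \_ (I n)) x)%E.
  rewrite -integral_mkcondr; congr integral; apply/esym/setIidr.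
  by move=> x /I_sub; rewrite /= in_itv.
rewrite /mkset (funext D).
apply: (@dominated_cvg _ _ _ leb `]a, b[%classic _ _ _ (EFin \o (fun x => `|f x|))) => //.
- move=> n; apply/(measurable_restrict _ (mI n)); first exact: measurable_itv.
  by apply/measurable_EFinP; apply: mf => [|x []//]; exact: measurableI.
- move=> x /= xab.
  have [n _ In] : (\bigcup_n I n) x by rewrite I_bigcup.
  apply: cvg_near_cst; exists n => // m /= nm; apply/esym.
  rewrite patchE mem_set//; have := I_nondec nm; rewrite subsetEset; exact.
- exact: integrable_norm.
- by move=> n x _; rewrite patchE; case: ifP => _ //=; rewrite normr0 lee_fin.
Qed.

End open_interval_FTC.

(** * Integrals of powers *)

Section powers.
Context {R : realType}.
Local Notation leb := (@lebesgue_measure R).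
Implicit Types (a b c h p q r t x : R).

Lemma is_derive_powRB c p x : x < c ->
  is_derive x 1 (fun y : R => (c - y) `^ p) (- (p * (c - x) `^ (p - 1))).
Proof.
move=> xc; have cx : 0 < c - x by rewrite subr_gt0.
have d1 : is_derive x 1 (fun y : R => c - y) (- 1).
  have -> : (fun y : R => c - y) = cst c - id by [].
  by apply: is_derive_eq; rewrite sub0r.
have d2 := is_derive1_powR p cx.
have -> : (fun y : R => (c - y) `^ p) = (@powR R ^~ p) \o (fun y : R => c - y) by [].
split.
  apply: diff_derivable; apply: differentiable_comp; apply/derivable1_diffP.
    exact: ex_derive.
  exact: ex_derive.
rewrite -derive1E.
rewrite derive1_comp; [|exact: ex_derive|exact: ex_derive].
by rewrite !derive1E; have [_ ->] := d1; have [_ ->] := d2; rewrite mulrN1.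
Qed.

Lemma powR_cvg_at_left b p : 0 < p -> (b - x) `^ p @[x --> b^'-] --> 0.
Proof.
move=> p0; apply/cvgrPdist_lt => e e0.
have /cvgrPdist_lt/(_ _ e0)[d /= d0 H] := @powR_cvg0 R p p0.
exists d => //= y; rewrite /= => yb xb; apply: H; rewrite /= ?subr_gt0//.
by rewrite sub0r normrN.
Qed.

Lemma powR_small p (k e : R) : 0 < p -> 0 <= k -> 0 < e ->
  exists2 r, 0 < r & forall h, 0 < h < r -> k * h `^ p <= e.
Proof.
move=> p0 k0 e0; have k1 : 0 < k + 1 by rewrite ltr_wpDl.
have ek0 : 0 < e / (k + 1) by rewrite divr_gt0.
have /cvgrPdist_lt/(_ _ ek0)[r /= r0 H] := @powR_cvg0 R p p0.
exists r => // h /andP[h0 hr]; have := H h; rewrite /= sub0r normrN gtr0_norm//.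
rewrite sub0r normrN ger0_norm ?powR_ge0// => /(_ hr h0).
rewrite ltr_pdivlMr// => H1; apply: ltW; apply: le_lt_trans H1.
by rewrite mulrC ler_wpM2l ?powR_ge0// lerDl.
Qed.

Lemma powR_continuous_gt0 p x : 0 < x -> {for x, continuous (fun y : R => y `^ p)}.
Proof.
move=> x0; apply/differentiable_continuous/derivable1_diffP.
by have := is_derive1_powR p x0 => ?; exact: ex_derive.
Qed.

Lemma powRB_continuous_lt c p x : x < c ->
  {for x, continuous (fun y : R => (c - y) `^ p)}.
Proof.
move=> x0; apply/differentiable_continuous/derivable1_diffP.
by have := is_derive_powRB p x0 => ?; exact: ex_derive.
Qed.

Lemma powR_within_continuous b p : 0 < b -> 0 < p ->
  {within `[0, b], continuous (fun y : R => y `^ p)}.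
Proof.
move=> b0 p0; apply/continuous_within_itvP => //; split.
- move=> x; rewrite in_itv/= => /andP[x0 _]; exact: powR_continuous_gt0.
- by rewrite powR0 ?gt_eqF//; exact: powR_cvg0.
- by apply: cvg_at_left_filter; exact: powR_continuous_gt0.
Qed.

Lemma powRB_within_continuous a b p : a < b -> 0 < p ->
  {within `[a, b], continuous (fun y : R => (b - y) `^ p)}.
Proof.
move=> ab p0; apply/continuous_within_itvP => //; split.
- move=> x; rewrite in_itv/= => /andP[_ xb]; exact: powRB_continuous_lt.
- by apply: cvg_at_right_filter; exact: powRB_continuous_lt.
- by rewrite subrr powR0 ?gt_eqF//; exact: powR_cvg_at_left.
Qed.

Lemma within_continuous_scale (D : set R) (f : R -> R) k :
  {within D, continuous f} -> {within D, continuous (fun x => k * f x)}.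
Proof. by move=> cf x; apply: cvgMr; exact: cf. Qed.

Section power_integrals.
Variables (b p : R).
Hypotheses (b0 : 0 < b) (p0 : 0 < p).

Let cF : {within `[0, b], continuous (fun x : R => p^-1 * x `^ p)}.
Proof. by apply: within_continuous_scale; exact: powR_within_continuous. Qed.

Let dF x : 0 < x < b -> is_derive x 1 (fun x => p^-1 * x `^ p) (x `^ (p - 1)).
Proof.
move=> /andP[x0 _]; have := is_derive1_powR p x0 => d.
have -> : (fun x : R => p^-1 * x `^ p) = p^-1 \*: (fun x : R => x `^ p) by [].
by apply: is_derive_eq; rewrite /GRing.scale/= mulKf// gt_eqF.
Qed.

Let cf x : 0 < x < b -> {for x, continuous (fun x : R => x `^ (p - 1))}.
Proof. by move=> /andP[x0 _]; exact: powR_continuous_gt0. Qed.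

Lemma integrable_powR : leb.-integrable `]0, b[ (fun x => (x `^ (p - 1))%:E).
Proof.
by apply: (ge0_integrable_oo b0 cF dF cf) => x _; exact: powR_ge0.
Qed.

Let cFB : {within `[0, b], continuous (fun x : R => - p^-1 * (b - x) `^ p)}.
Proof. by apply: within_continuous_scale; exact: powRB_within_continuous. Qed.

Let dFB x : 0 < x < b ->
  is_derive x 1 (fun x => - p^-1 * (b - x) `^ p) ((b - x) `^ (p - 1)).
Proof.
move=> /andP[_ xb]; have := is_derive_powRB p xb => d.
have -> : (fun x : R => - p^-1 * (b - x) `^ p) = (- p^-1) \*: (fun x : R => (b - x) `^ p) by [].
by apply: is_derive_eq; rewrite /GRing.scale/= mulrNN mulKf// gt_eqF.
Qed.

Let cfB x : 0 < x < b -> {for x, continuous (fun x : R => (b - x) `^ (p - 1))}.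
Proof. by move=> /andP[_ xb]; exact: powRB_continuous_lt. Qed.

Lemma integrable_powRB :
  leb.-integrable `]0, b[ (fun x => ((b - x) `^ (p - 1))%:E).
Proof.
by apply: (ge0_integrable_oo b0 cFB dFB cfB) => x _; exact: powR_ge0.
Qed.

Lemma Rintegral_powRB :
  \int[leb]_(x in `]0, b[) (b - x) `^ (p - 1) = b `^ p / p.
Proof.
rewrite (Rintegral_FTC_oo b0 cFB dFB cfB integrable_powRB).
by rewrite subr0 subrr powR0 ?gt_eqF// mulr0 sub0r mulNr opprK mulrC.
Qed.

End power_integrals.

Lemma powR_noninc p x y : p <= 0 -> 0 < x -> x <= y -> y `^ p <= x `^ p.
Proof.
move=> p0 x0 xy; have y0 := lt_le_trans x0 xy.
rewrite -[p]opprK !(powRN _ (- p)) lef_pV2 ?posrE ?powR_gt0//.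
by apply: ge0_ler_powR => //; rewrite ?oppr_ge0// nnegrE ltW.
Qed.

(** On each half of the interval one of the two factors is bounded. *)
Lemma integrable_beta b p q : 0 < b -> 0 < p <= 1 -> 0 < q <= 1 ->
  leb.-integrable `]0, b[ (fun x => (x `^ (p - 1) * (b - x) `^ (q - 1))%:E).
Proof.
move=> b0 /andP[p0 p1] /andP[q0 q1].
have b20 : 0 < b / 2 by rewrite divr_gt0.
have i1 : leb.-integrable `]0, b[ (fun x => ((b / 2) `^ (q - 1) * x `^ (p - 1))%:E).
  exact: (@integrableZl _ _ _ leb _ _ _ _ (integrable_powR b0 p0)).
have i2 : leb.-integrable `]0, b[ (fun x => ((b / 2) `^ (p - 1) * (b - x) `^ (q - 1))%:E).
  exact: (@integrableZl _ _ _ leb _ _ _ _ (integrable_powRB b0 q0)).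
apply: (le_integrable _ _ _ (integrableD _ i1 i2)) => //.
  apply/measurable_EFinP/measurable_funM.
    exact/measurable_EFinP/measurable_int/integrable_powR.
  exact/measurable_EFinP/measurable_int/integrable_powRB.
move=> x; rewrite /= in_itv/= => /andP[x0 xb].
rewrite lee_fin !ger0_norm ?addr_ge0 ?mulr_ge0 ?powR_ge0//.
have [xb2|xb2] := leP x (b / 2).
  rewrite ler_wpDr ?mulr_ge0 ?powR_ge0// mulrC ler_wpM2r ?powR_ge0//.
  by apply: powR_noninc => //; lra.
rewrite ler_wpDl ?mulr_ge0 ?powR_ge0// ler_wpM2r ?powR_ge0//.
by apply: powR_noninc => //; lra.
Qed.

(** For [h > 0] the singularity of [(t + h - x) `^ (p - 1)] lies to the right of the
    interval, hence [p < 0] here. *)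
Section shifted_power_integrals.
Variables (t h p : R).
Hypotheses (t0 : 0 < t) (h0 : 0 < h) (p0 : p < 0).

Let lt_tDh x : x <= t -> x < t + h.
Proof. by move=> xt; rewrite (le_lt_trans xt)// ltrDl. Qed.

Let cF : {within `[0, t], continuous (fun x : R => - p^-1 * (t + h - x) `^ p)}.
Proof.
apply: within_continuous_scale; apply: continuous_in_subspaceT => x /set_mem.
by rewrite /= in_itv/= => /andP[_ /lt_tDh]; exact: powRB_continuous_lt.
Qed.

Let dF x : 0 < x < t -> is_derive x 1 (fun x => - p^-1 * (t + h - x) `^ p)
  ((t + h - x) `^ (p - 1)).
Proof.
move=> /andP[_ /ltW/lt_tDh] /(is_derive_powRB p) d.
have -> : (fun x : R => - p^-1 * (t + h - x) `^ p) =
  (- p^-1) \*: (fun x : R => (t + h - x) `^ p) by [].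
by apply: is_derive_eq; rewrite /GRing.scale/= mulrNN mulKf// lt_eqF.
Qed.

Let cf x : 0 < x < t -> {for x, continuous (fun x : R => (t + h - x) `^ (p - 1))}.
Proof. by move=> /andP[_ /ltW/lt_tDh]; exact: powRB_continuous_lt. Qed.

Lemma integrable_powRDB :
  leb.-integrable `]0, t[ (fun x => ((t + h - x) `^ (p - 1))%:E).
Proof.
by apply: (ge0_integrable_oo t0 cF dF cf) => x _; exact: powR_ge0.
Qed.

Lemma Rintegral_powRDB :
  - p * \int[leb]_(x in `]0, t[) (t + h - x) `^ (p - 1) = h `^ p - (t + h) `^ p.
Proof.
rewrite (Rintegral_FTC_oo t0 cF dF cf integrable_powRDB).
rewrite subr0 [t + h - t]addrC addKr.
by rewrite -mulrBr mulrA mulrNN divff ?mul1r ?lt_eqF.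
Qed.

End shifted_power_integrals.

(** By dominated convergence along [h = 1 / (n + 1)]; the integral increases with [h]. *)
Lemma shifted_kernel_small t p (e : R) : 0 < t -> 0 < p < 1 -> 0 < e ->
  exists2 r, 0 < r & forall h, 0 < h < r ->
    leb.-integrable `]0, t[
      (fun x => (((t - x) `^ (- p) - (t + h - x) `^ (- p)) * x `^ (p - 1))%:E) /\
    \int[leb]_(x in `]0, t[)
      (((t - x) `^ (- p) - (t + h - x) `^ (- p)) * x `^ (p - 1)) <= e.
Proof.
move=> t0 /andP[p0 p1] e0.
have mI : measurable (`]0, t[%classic : set (measurableTypeR R)) by exact: measurable_itv.
pose f h x : R := ((t - x) `^ (- p) - (t + h - x) `^ (- p)) * x `^ (p - 1).
have np : - p <= 0 by rewrite oppr_le0 ltW.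
have f_ge0 h x : 0 <= h -> 0 < x < t -> 0 <= f h x.
  move=> h0 /andP[x0 xt]; rewrite mulr_ge0 ?powR_ge0// subr_ge0.
  by apply: powR_noninc => //; rewrite ?subr_gt0// lerD2r lerDl.
have f_mono h k x : 0 < x < t -> 0 <= h -> h <= k -> f h x <= f k x.
  move=> /andP[x0 xt] h0 hk; rewrite ler_wpM2r ?powR_ge0// lerD2l lerN2.
  by apply: powR_noninc => //; [rewrite subr_gt0 (lt_le_trans xt)// lerDl|rewrite lerD2r lerD2l].
have a1 : 0 < p <= 1 by rewrite p0 ltW.
have b1 : 0 < 1 - p <= 1 by rewrite subr_gt0 p1 gerBl ltW.
have ig := integrable_beta t0 a1 b1.
have f_le h x : 0 <= h -> 0 < x < t -> f h x <= x `^ (p - 1) * (t - x) `^ (1 - p - 1).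
  move=> h0 /andP[x0 xt]; rewrite /f mulrC ler_wpM2l ?powR_ge0//.
  by rewrite (_ : 1 - p - 1 = - p); [rewrite gerBl powR_ge0|ring].
have mf h : measurable_fun `]0, t[ (f h).
  have mp (a c q : R) : measurable_fun `]0, t[ (fun x : R => (a + c * x) `^ q).
    apply: (@measurableT_comp _ _ _ _ _ _ (fun x : R => x `^ q)) => //.
    by apply: measurable_funD => //; exact: measurable_funM.
  apply: measurable_funM; last first.
    by have := mp 0 1 (p - 1); apply: eq_measurable_fun => x _; rewrite add0r mul1r.
  apply: measurable_funB.
    by have := mp t (-1) (- p); apply: eq_measurable_fun => x _; rewrite mulN1r.
  by have := mp (t + h) (-1) (- p); apply: eq_measurable_fun => x _; rewrite mulN1r.
have fi h : 0 <= h -> leb.-integrable `]0, t[ (EFin \o f h).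
  move=> h0; apply: (le_integrable mI _ _ ig); first by apply/measurable_EFinP; exact: mf.
  move=> x; rewrite /= in_itv/= => xt; rewrite lee_fin ger0_norm ?f_ge0//.
  by rewrite (le_trans (f_le _ _ h0 xt))// ler_norm.
have cvg0 : (\int[leb]_(x in `]0%R, t[) (f n.+1%:R^-1 x)%:E)%E @[n --> \oo] --> 0%E.
  have -> : 0%E = (\int[leb]_(x in (`]0%R, t[%classic : set R)) cst 0 x)%E.
    by rewrite integral0.
  apply: (@dominated_cvg _ _ _ leb `]0, t[%classic mI
    (fun n x => (f n.+1%:R^-1 x)%:E) (cst 0%E) _ _ _ _ ig) => //.
  - by move=> n; apply/measurable_EFinP; exact: mf.
  - move=> x; rewrite /= in_itv/= => /andP[x0 xt].
    apply: cvg_EFin; first exact: nearW.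
    rewrite -(mul0r (x `^ (p - 1))); apply: cvgMl.
    rewrite -(subrr ((t - x) `^ (- p))); apply: cvgB; first exact: cvg_cst.
    have tx : 0 < t - x by rewrite subr_gt0.
    apply: (@cvg_comp _ _ _ (fun n => t + n.+1%:R^-1 - x) (fun y : R => y `^ (- p)) _ (nbhs (t - x))).
      rewrite -{2}[t]addr0; apply: cvgB; last exact: cvg_cst.
      by apply: cvgD; [exact: cvg_cst|exact: cvg_harmonic].
    exact: powR_continuous_gt0.
  - move=> n x; rewrite /= in_itv/= => xt.
    by rewrite lee_fin ger0_norm ?f_ge0 ?f_le.
have e0' : (0 < e%:E)%E by rewrite lte_fin.
have [n _ Hn] : \forall n \near \oo,
    (\int[leb]_(x in `]0%R, t[) (f n.+1%:R^-1 x)%:E < e%:E)%E.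
  have /= := cvg0 [set x | (x < e%:E)%E] _; apply.
  by apply: open_nbhs_nbhs; split; [exact: open_ereal_lt_ereal|].
have n0 : 0 < n.+1%:R^-1 :> R by rewrite invr_gt0.
exists n.+1%:R^-1 => // h /andP[h0 hn]; split; first exact/fi/ltW.
apply: (@le_trans _ _ (\int[leb]_(x in `]0, t[) f n.+1%:R^-1 x)).
  apply: (le_Rintegral mI (fi _ (ltW h0)) (fi _ (ltW n0))) => x; rewrite /= in_itv/= => xt.
  by apply: f_mono => //; exact: ltW.
rewrite -lee_fin /Rintegral fineK; first exact/ltW/Hn/leqnn.
exact: (integrable_fin_num mI (fi _ (ltW n0))).
Qed.

End powers.

(** * A criterion for monotonicity *)

(** A supremum argument in place of differentiation: a function whose right
    difference quotients are eventually below every positive number, and that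
    does not jump upwards from the left, is nonincreasing. *)
Lemma nonincreasing_of_dini (R : realType) (phi : R -> R) (a b : R) : a <= b ->
  (forall c, a < c <= b -> forall e, 0 < e -> exists2 d, 0 < d &
     forall h, 0 < h < d -> a <= c - h -> phi c <= phi (c - h) + e) ->
  (forall c, a <= c < b -> forall e, 0 < e -> exists2 d, 0 < d &
     forall h, 0 < h < d -> phi (c + h) <= phi c + e * h) ->
  phi b <= phi a.
Proof.
move=> ab left right.
suff H e : 0 < e -> phi b <= phi a + e * (b - a).
  apply/ler_addgt0Pr => e e0.
  have e'0 : 0 < e / (b - a + 1) by rewrite divr_gt0// ltr_wpDl// subr_ge0.
  apply: (le_trans (H _ e'0)); rewrite lerD2l mulrAC ler_pdivrMr.
    by rewrite ler_wpM2l ?ltW// ltrDl.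
  by rewrite ltr_wpDl// subr_ge0.
move=> e0; pose P r := phi r <= phi a + e * (r - a).
pose A := [set r | a <= r <= b /\ forall s, a <= s <= r -> P s].
have Pa : P a by rewrite /P subrr mulr0 addr0.
have Aa : A a.
  split; first by rewrite lexx.
  by move=> s /andP[? ?]; have -> : s = a by apply/le_anti/andP.
have supA : has_sup A by split; [exists a|exists b => r [/andP[]]].
pose c := sup A.
have ac : a <= c by apply: ub_le_sup => //; exact: supA.2.
have cb : c <= b by apply: ge_sup; [exact: supA.1|move=> r [/andP[]]].
have below s : a <= s -> s < c -> P s.
  move=> as_ sc; have cs : 0 < c - s by rewrite subr_gt0.
  have [r [_ Ar]] := sup_adherent cs supA.
  by rewrite -/c subKr => sr; apply: Ar; rewrite as_ ltW.
have Pc : P c.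
  have [<-//|ac'] := eqVneq a c; have {}ac : a < c by rewrite lt_neqAle ac'.
  apply/ler_addgt0Pr => k k0.
  have [|d d0 H] := left c _ k k0; first by rewrite ac.
  pose h := Num.min (d / 2) (c - a).
  have h0 : 0 < h by rewrite lt_min divr_gt0//= subr_gt0.
  have hd : h < d by rewrite gt_min; apply/orP; left; lra.
  have hca : a <= c - h by rewrite lerBrDr -lerBrDl ge_min lexx orbT.
  apply: (le_trans (H h _ hca)); first by rewrite h0.
  rewrite lerD2r (le_trans (below _ hca _)) ?ltrBlDr ?ltrDl//.
  by rewrite lerD2l ler_wpM2l ?ltW//; lra.
have [<-//|cb'] := eqVneq c b; have {}cb : c < b by rewrite lt_neqAle cb'.
have [|d d0 H] := right c _ e e0; first by rewrite ac.
(* The bound holds up to c and hence, by [right], a little beyond it. *)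
pose h := Num.min (d / 2) (b - c).
have h0 : 0 < h by rewrite lt_min divr_gt0//= subr_gt0.
have hd : h < d by rewrite gt_min; apply/orP; left; lra.
have hb : c + h <= b by rewrite -lerBrDl ge_min lexx orbT.
suff : A (c + h).
  by move=> /(ub_le_sup supA.2); rewrite -/c gerDl leNgt h0.
split; first by rewrite hb andbT; lra.
move=> s /andP[as_ sch].
have [sc|cs] := ltP s c; first exact: below.
have [->//|sc] := eqVneq s c; have {}cs : c < s by rewrite lt_neqAle eq_sym sc.
have -> : s = c + (s - c) by lra.
apply: (le_trans (H (s - c) _)); first by apply/andP; split; lra.
by move: Pc; rewrite /P; lra.
Qed.

(** * Borel sets of row vectors *)

Section borel_rV.
Context {R : realType} {d : nat}.
Local Notation X := 'rV[R]_d.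
Local Notation vol := (lebesgue_rV (R := R) d).

(** An open set is the union of the cubes with rational centre and radius
    [1 / (n + 1)] that it contains, which are countably many. *)
Lemma open_measurable_rV (A : set X) : open A -> measurable A.
Proof.
move=> oA.
pose box (p : 'rV[rat]_d * nat) : set X :=
  [set v | forall i, `|v ord0 i - ratr (p.1 ord0 i)| < p.2.+1%:R^-1].
have mbox p : measurable (box p).
  rewrite (_ : box p = \bigcap_(i in [set: 'I_d])
    ((fun v : X => v ord0 i) @^-1`
      [set x : R | `|x - ratr (p.1 ord0 i)| < p.2.+1%:R^-1])); last first.
    by apply/seteqP; split => v bv i; [move=> _; exact: bv|exact: (bv i Logic.I)].
  apply: fin_bigcap_measurable => // i _.
  have := @measurable_coord_rV _ (measurableTypeR R) d i measurableT.
  move=> /(_ [set x : R | `|x - ratr (p.1 ord0 i)| < p.2.+1%:R^-1]).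
  rewrite setTI; apply; apply: open_measurable.
  rewrite (_ : [set _ | _] = ball (ratr (p.1 ord0 i) : R) p.2.+1%:R^-1).
    exact: ball_open.
  by apply/seteqP; split => x /=; rewrite /ball/= distrC.
rewrite (_ : A = \bigcup_p (if `[< box p `<=` A >] then box p else set0)).
  apply: countable_bigcupT_measurable => //= p.
  by case: ifP => _ //; exact: measurable0.
apply/seteqP; split => [v Av|v [p _]]; last by case: ifPn => // /asboolP; exact.
have /nbhs_ballP[e /= e0 eA] : nbhs v A by rewrite nbhsE; exists A.
have e20 : 0 < e / 2 by rewrite divr_gt0.
pose n := Num.truncn (e / 2)^-1.
have ne : n.+1%:R^-1 < e / 2.
  rewrite -[ltRHS]invrK ltf_pV2 ?posrE ?invr_gt0//.
  exact: truncnS_gt.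
have n0 : 0 < n.+1%:R^-1 :> R by rewrite invr_gt0.
have qP i : exists q : rat, `|v ord0 i - ratr q| < n.+1%:R^-1.
  have /rat_in_itvoo[q] : v ord0 i < v ord0 i + n.+1%:R^-1 by rewrite ltrDl.
  rewrite in_itv/= => /andP[vq qv]; exists q.
  by rewrite distrC gtr0_norm ?subr_gt0// ltrBlDl.
pose q : 'rV[rat]_d := \row_i sval (cid (qP i)).
exists (q, n) => //; rewrite asboolT.
  by move=> i /=; rewrite mxE; exact: (svalP (cid (qP i))).
move=> w bw; apply: eA; split => // i j; rewrite (ord1 i) /ball/=.
have := bw j; have := svalP (cid (qP j)); rewrite /= !mxE.
move: (ratr _) => r H1 H2.
rewrite (le_lt_trans (ler_distD r _ _))// [e]splitr ltrD//.
  exact: lt_trans ne.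
by rewrite distrC; exact: lt_trans ne.
Qed.

Lemma continuous_measurable_rV (f : X -> R) : continuous f ->
  measurable_fun setT f.
Proof.
move=> /continuousP cf; apply: (measurability _ (RGenOpens.measurableE R)).
move=> _ [_ [a [b ->] <-]]; rewrite setTI; apply: open_measurable_rV.
exact/cf/interval_open.
Qed.

(** The sets to which bounded sets are compared: they are compact, and
    [lebesgue_rV_box] computes their measure. *)
Definition cube (M : R) : set X :=
  [set v | forall i, `[- M, M]%classic (v ord0 i)].

Lemma bounded_sub_cube (A : set X) : bounded_set A -> exists M, A `<=` cube M.
Proof.
move=> [M [Mr bA]]; exists (M + 1) => v Av i; rewrite /= in_itv/= -ler_norml.
have := bA (M + 1); rewrite ltrDl ltr01 => /(_ isT) /(_ v Av) /=.
apply: le_trans; rewrite -[leRHS]/(mx_norm v) mx_normrE.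
exact: (le_bigmax _ (fun ij => `|v ij.1 ij.2|) (ord0, i)).
Qed.

Lemma compact_cube M : compact (cube M).
Proof. by apply: (@rV_compact R d (fun=> _)) => i; exact: segment_compact. Qed.

Lemma lebesgue_cube_lty M : (vol (cube M) < +oo)%E.
Proof.
rewrite (lebesgue_rV_box (A := fun=> `[- M, M]%classic))//.
suff /andP[] : (0 <= \prod_(i < d) lebesgue_measure (`[(- M)%R, M]%classic : set R) < +oo)%E by [].
elim/big_ind : _ => [|x y /andP[x0 xoo] /andP[y0 yoo]|i _].
- by rewrite lee01 ltry.
- by rewrite mule_ge0//= lte_mul_pinfty// ge0_fin_numE.
- by rewrite measure_ge0/= lebesgue_measure_itv/=; case: ifP => _; rewrite -?EFinB ltry.
Qed.

Lemma lebesgue_bounded_lty (A : set X) : measurable A -> bounded_set A ->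
  (vol A < +oo)%E.
Proof.
move=> mA /bounded_sub_cube[M AM].
apply: le_lt_trans (lebesgue_cube_lty M); apply: le_measure; rewrite ?inE//.
rewrite (_ : cube M = \bigcap_(i in [set: 'I_d])
  ((fun v : X => v ord0 i) @^-1` `[- M, M]%classic)).
  apply: fin_bigcap_measurable => // i _.
  have := @measurable_coord_rV _ (measurableTypeR R) d i measurableT.
  by move=> /(_ `[- M, M]%classic); rewrite setTI; apply; exact: measurable_itv.
by apply/seteqP; split => v bv i; [move=> _; exact: bv|exact: (bv i Logic.I)].
Qed.

Lemma continuous_bounded_on (f : X -> R) (A : set X) : continuous f ->
  bounded_set A -> exists M, forall x, A x -> `|f x| <= M.
Proof.
move=> cf /bounded_sub_cube[M AM].
have : compact (f @` cube M).
  by apply: continuous_compact; [exact: continuous_subspaceT|exact: compact_cube].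
move=> /compact_bounded[K [Kr fK]]; exists (K + 1) => x /AM Mx.
by have := fK (K + 1); rewrite ltrDl ltr01 => /(_ isT); apply; exists x.
Qed.

End borel_rV.

(** * The inner product of L2 *)

(** Locked, because its arguments are often weak derivatives, which are chosen by
    [xget] and which conversion must not unfold. *)
HB.lock Definition ip {R : realType} {d : nat} (Omega : set 'rV[R]_d)
    (f g : 'rV[R]_d -> R) : R :=
  \int[lebesgue_rV d]_(x in Omega) (f x * g x).

Section L2_space.
Context {R : realType} {d : nat} (Omega : set 'rV[R]_d).
Local Notation X := 'rV[R]_d.
Local Notation vol := (lebesgue_rV (R := R) d).
Local Notation L2 := (L2 Omega).
Local Notation nrm := (L2norm Omega).
Implicit Types (f g h : X -> R) (k : R).
Hypothesis mO : measurable Omega.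

Local Notation ip := (ip Omega).

Lemma ipE f g : ip f g = \int[vol]_(x in Omega) (f x * g x).
Proof. by rewrite ip.unlock. Qed.

Let p1 : (1 <= 2%:E :> \bar R)%E.
Proof. by rewrite lee_fin ler1n. Qed.

Lemma L2_0 : L2 (cst 0).
Proof.
rewrite /Defs.L2/= (_ : patch _ _ _ = cst 0).
  have := Lfun_addr_closed vol p1; by case.
by apply/funext => x; rewrite patchE; case: ifP.
Qed.

Lemma L2D f g : L2 f -> L2 g -> L2 (f \+ g).
Proof.
rewrite /Defs.L2/= => Lf Lg.
rewrite (_ : patch _ _ _ = (f \_ Omega) + (g \_ Omega)).
  by apply: (Lfun_addr_closed vol p1).2.
by apply/funext => x; rewrite !fctE !patchE; case: ifP; rewrite // addr0.
Qed.

Lemma L2Z k f : L2 f -> L2 (fun x => k * f x).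
Proof.
rewrite /Defs.L2/= => /(Lfun_scale k) Lf.
rewrite (_ : patch _ _ _ = k \o* (f \_ Omega)); first by apply: Lf; rewrite ler1n.
by apply/funext => x; rewrite /= !patchE; case: ifP; rewrite ?mulr0 ?mul0r// mulrC.
Qed.

Lemma L2N f : L2 f -> L2 (fun x => - f x).
Proof. by move=> /(L2Z (-1)); under eq_fun do rewrite mulN1r. Qed.

Lemma L2B f g : L2 f -> L2 g -> L2 (f \- g).
Proof. by move=> Lf /L2N; exact: L2D. Qed.

Lemma L2_sum (I : Type) (r : seq I) (F : I -> X -> R) :
  (forall i, L2 (F i)) -> L2 (fun x => \sum_(i <- r) F i x).
Proof.
move=> LF; elim: r => [|i r ih].
  by under eq_fun do rewrite big_nil; exact: L2_0.
by under eq_fun do rewrite big_cons; exact: L2D.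
Qed.

Lemma L2_measurable f : L2 f -> measurable_fun Omega f.
Proof.
rewrite /Defs.L2/= inE => /andP[]; rewrite inE/= => mf _.
exact/(measurable_restrictT f mO).
Qed.

Lemma L2_integrable f g : L2 f -> L2 g ->
  vol.-integrable Omega (EFin \o (fun x => f x * g x)).
Proof.
rewrite /Defs.L2/= => Lf Lg; apply/(integrable_mkcond _ mO).
have /Lfun1_integrable := Lfun2_mul_Lfun1 Lf Lg.
apply: eq_integrable => // x _.
by rewrite /= !patchE; case: ifP => //; rewrite mulr0.
Qed.

Lemma ipC f g : ip f g = ip g f.
Proof. by rewrite !ipE; apply: eq_Rintegral => x _; rewrite mulrC. Qed.

Lemma ipDl f g h : L2 f -> L2 g -> L2 h -> ip (f \+ g) h = ip f h + ip g h.
Proof.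
move=> Lf Lg Lh; rewrite !ipE -RintegralD//; last 2 first.
  exact: L2_integrable.
  exact: L2_integrable.
by apply: eq_Rintegral => x _; rewrite mulrDl.
Qed.

Lemma ipZl k f h : L2 f -> L2 h -> ip (fun x => k * f x) h = k * ip f h.
Proof.
move=> Lf Lh; rewrite !ipE -RintegralZl//; last exact: L2_integrable.
by apply: eq_Rintegral => x _; rewrite mulrA.
Qed.

Lemma ipBl f g h : L2 f -> L2 g -> L2 h -> ip (f \- g) h = ip f h - ip g h.
Proof.
move=> Lf Lg Lh; rewrite !ipE -RintegralB//; last 2 first.
  exact: L2_integrable.
  exact: L2_integrable.
by apply: eq_Rintegral => x _; rewrite mulrBl.
Qed.

Lemma ipDr f g h : L2 f -> L2 g -> L2 h -> ip h (f \+ g) = ip h f + ip h g.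
Proof. by move=> *; rewrite ipC ipDl// !(ipC h). Qed.

Lemma ipBr f g h : L2 f -> L2 g -> L2 h -> ip h (f \- g) = ip h f - ip h g.
Proof. by move=> *; rewrite ipC ipBl// !(ipC h). Qed.

Lemma ipZr k f h : L2 f -> L2 h -> ip h (fun x => k * f x) = k * ip h f.
Proof. by move=> *; rewrite ipC ipZl// (ipC h). Qed.

Lemma ip0l h : ip (cst 0) h = 0.
Proof.
rewrite !ipE (@eq_Rintegral _ _ _ _ _ (cst 0)); last by move=> x _; rewrite mul0r.
by rewrite Rintegral_cst// mul0r.
Qed.

Lemma ip_suml (I : Type) (r : seq I) (F : I -> X -> R) h :
  (forall i, L2 (F i)) -> L2 h ->
  ip (fun x => \sum_(i <- r) F i x) h = \sum_(i <- r) ip (F i) h.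
Proof.
move=> LF Lh; elim: r => [|i r ih].
  by rewrite big_nil -[RHS](ip0l h) !ipE; apply: eq_Rintegral => x _; rewrite big_nil.
rewrite big_cons -ih -ipDl//; last exact: L2_sum.
by rewrite !ipE; apply: eq_Rintegral => x _; rewrite big_cons.
Qed.

Lemma ip_ge0 f : 0 <= ip f f.
Proof. by rewrite ipE; apply: Rintegral_ge0 => x _; rewrite -expr2 sqr_ge0. Qed.

Lemma L2norm_ge0 f : 0 <= nrm f.
Proof. by rewrite /L2norm fine_ge0// Lnorm_ge0. Qed.

Lemma L2normE f : nrm f ^+ 2 = ip f f.
Proof.
rewrite /L2norm unlock /=.
set A := (\int[vol]_x _)%E.
have A0 : (0 <= A)%E.
  by apply: integral_ge0 => x _; rewrite lee_fin powR_ge0.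
have AE : A = (\int[vol]_(x in Omega) (f x * f x)%:E)%E.
  rewrite integral_mkcond; apply: eq_integral => x _.
  rewrite /= !patchE; case: ifP => _; last by rewrite normr0 powR0.
  by rewrite powR_mulrn// -normrX ger0_norm ?sqr_ge0// expr2.
rewrite !ipE /Rintegral -AE; move: A A0 {AE} => [r|//|//]; last first.
  by rewrite /= invr_eq0 pnatr_eq0 /= expr2 mul0r.
rewrite lee_fin => r0 /=.
by rewrite -[_ ^+ 2]powR_mulrn ?powR_ge0// -powRrM mulVf// powRr1.
Qed.

Lemma L2norm_sqrt f : nrm f = Num.sqrt (ip f f).
Proof. by rewrite -L2normE sqrtr_sqr ger0_norm// L2norm_ge0. Qed.

Lemma L2norm0 : nrm (cst 0) = 0.
Proof. by rewrite L2norm_sqrt ip0l sqrtr0. Qed.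

(** The discriminant of the nonnegative quadratic [k |-> ip (f - k g) (f - k g)]. *)
Lemma cauchy_schwarz f g : L2 f -> L2 g -> `|ip f g| <= nrm f * nrm g.
Proof.
move=> Lf Lg; rewrite -ler_sqr ?nnegrE ?mulr_ge0 ?L2norm_ge0//.
rewrite -normrX ger0_norm ?sqr_ge0// exprMn !L2normE.
have Q k : 0 <= ip f f - 2 * k * ip f g + k ^+ 2 * ip g g.
  have L := L2Z k Lg.
  have := ip_ge0 (f \- (fun x => k * g x)).
  rewrite ipBl//; last exact: L2B.
  rewrite !ipBr// !ipZl// !ipZr// (ipC g f); lra.
have [g0|g0] := eqVneq (ip g g) 0.
  suff -> : ip f g = 0 by rewrite expr0n/= mulr_ge0// ip_ge0.
  apply/eqP/negPn/negP => fg0.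
  (* The quadratic is affine; here it would take the value -1. *)
  have := Q ((ip f f + 1) / (2 * ip f g)); rewrite g0 mulr0 addr0.
  rewrite (_ : 2 * _ * _ = ip f f + 1); first by lra.
  by field.
have {}g0 : 0 < ip g g by rewrite lt_neqAle eq_sym g0 ip_ge0.
rewrite -subr_ge0.
have -> : ip f f * ip g g - ip f g ^+ 2 = ip g g *
    (ip f f - 2 * (ip f g / ip g g) * ip f g + (ip f g / ip g g) ^+ 2 * ip g g).
  by field; rewrite gt_eqF.
by rewrite mulr_ge0 ?Q// ltW.
Qed.

Lemma ler_ip f g : L2 f -> L2 g -> ip f g <= nrm f * nrm g.
Proof. by move=> Lf Lg; exact: le_trans (ler_norm _) (cauchy_schwarz Lf Lg). Qed.

Lemma L2norm_sqD f g : L2 f -> L2 g ->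
  nrm (f \+ g) ^+ 2 = nrm f ^+ 2 + 2 * ip f g + nrm g ^+ 2.
Proof.
move=> Lf Lg; rewrite !L2normE ipDl//; last exact: L2D.
rewrite !ipDr// (ipC g f); ring.
Qed.

Lemma L2normD f g : L2 f -> L2 g -> nrm (f \+ g) <= nrm f + nrm g.
Proof.
move=> Lf Lg; rewrite -ler_sqr ?nnegrE ?addr_ge0 ?L2norm_ge0//.
rewrite L2norm_sqD// sqrrD; have := ler_ip Lf Lg; lra.
Qed.

Lemma L2normZ k f : L2 f -> nrm (fun x => k * f x) = `|k| * nrm f.
Proof.
move=> Lf; rewrite !L2norm_sqrt ipZl// ?ipZr//; last exact: L2Z.
by rewrite mulrA -expr2 sqrtrM ?sqr_ge0// sqrtr_sqr.
Qed.

Lemma eq_ip f f' g g' : {ae vol, forall x, Omega x -> f x = f' x} ->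
  {ae vol, forall x, Omega x -> g x = g' x} ->
  L2 f -> L2 g -> L2 f' -> L2 g' -> ip f g = ip f' g'.
Proof.
move=> ff gg Lf Lg Lf' Lg'; rewrite !ipE /Rintegral; congr fine.
apply: ae_eq_integral => //.
- exact: measurable_int (L2_integrable Lf Lg).
- exact: measurable_int (L2_integrable Lf' Lg').
- by apply: filterS2 ff gg => x fx gx Ox /=; rewrite fx// gx.
Qed.

Lemma L2dist_sym f g : L2dist Omega f g = L2dist Omega g f.
Proof.
rewrite /L2dist !L2norm_sqrt; congr Num.sqrt; rewrite !ipE; apply: eq_Rintegral => x _.
by rewrite /=; ring.
Qed.

Lemma L2dist_triangle f g h : L2 f -> L2 g -> L2 h ->
  L2dist Omega f h <= L2dist Omega f g + L2dist Omega g h.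
Proof.
move=> Lf Lg Lh; have := L2normD (L2B Lf Lg) (L2B Lg Lh).
apply: le_trans; rewrite le_eqVlt /L2dist; apply/orP; left; apply/eqP.
by congr L2norm; apply/funext => x /=; rewrite addrA subrK.
Qed.

Lemma continuous_L2 f : bounded_set Omega -> continuous f -> L2 f.
Proof.
move=> bO cf; rewrite /Defs.L2/= inE; have mf : measurable_fun setT (f \_ Omega).
  apply/(measurable_restrictT f mO).
  exact: measurable_funS (continuous_measurable_rV cf).
apply/andP; split.
  by rewrite inE.
have [M fM] := continuous_bounded_on cf bO.
rewrite inE/= /finite_norm unlock/= poweR_lty//.
apply: (@le_lt_trans _ _ (\int[vol]_(x in Omega) (`|M| `^ 2)%:E)%E).
  rewrite [leRHS]integral_mkcond; apply: ge0_le_integral => //.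
  - apply/measurable_EFinP.
    apply: (@measurableT_comp _ _ _ _ _ _ (fun x : R => x `^ 2)) => //.
    exact: measurableT_comp.
  - by apply/(measurable_restrictT _ mO).
  - move=> x _; rewrite /= !patchE; case: ifP => [/set_mem/fM fx|_].
      by rewrite lee_fin ge0_ler_powR// ?nnegrE// (le_trans fx)// ler_norm.
    by rewrite normr0 powR0.
by rewrite integral_cst// lte_mul_pinfty// ?lee_fin// lebesgue_bounded_lty.
Qed.

Lemma L2_dominated f g k : measurable_fun Omega g -> L2 f ->
  {ae vol, forall x, Omega x -> `|g x| <= k * `|f x|} -> L2 g.
Proof.
move=> mg Lf gf; have Lkf := L2Z k Lf.
have mrg : measurable_fun setT (g \_ Omega) by apply/(measurable_restrictT g mO).
move: Lkf; rewrite /Defs.L2/= !inE => /andP[]; rewrite !inE/= => mkf.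
rewrite /finite_norm unlock/= => kfoo; apply/andP; split; first by rewrite inE.
rewrite inE/= /finite_norm unlock/=; apply: le_lt_trans kfoo.
have mp (h : X -> R) : measurable_fun setT h ->
    measurable_fun setT (fun x => (`|h x| `^ 2)%:E).
  move=> mh; apply/measurable_EFinP.
  apply: (@measurableT_comp _ _ _ _ _ _ (fun x : R => x `^ 2)) => //.
  exact: measurableT_comp.
have i0 (h : X -> R) : (0 <= \int[vol]_x (`|h x| `^ 2)%:E)%E.
  by apply: integral_ge0 => x _; rewrite lee_fin powR_ge0.
apply: gt0_ler_poweR; rewrite ?invr_ge0 ?in_itv/= ?i0 ?leey//.
apply: ae_ge0_le_integral => //; [exact: mp|exact: mp|].
apply: filterS gf => x gx _; rewrite lee_fin !patchE.
case: ifP => [/set_mem/gx {}gx|_]; last by rewrite normr0.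
rewrite ge0_ler_powR// ?nnegrE// (le_trans gx)// normrM ler_wpM2r//.
exact: ler_norm.
Qed.

(** [g - f] agrees almost everywhere with its absolute value. *)
Lemma le_ae_Rintegral f g : vol.-integrable Omega (EFin \o f) ->
  vol.-integrable Omega (EFin \o g) ->
  {ae vol, forall x, Omega x -> f x <= g x} ->
  \int[vol]_(x in Omega) f x <= \int[vol]_(x in Omega) g x.
Proof.
move=> fi gi fg; rewrite -subr_ge0 -RintegralB//.
have gfi : vol.-integrable Omega (EFin \o (g \- f)) by exact: (integrableB mO gi fi).
have mgf := measurable_int _ gfi.
rewrite /Rintegral (@ae_eq_integral _ _ _ vol _ (EFin \o (fun x => `|g x - f x|)))//.
- by apply: Rintegral_ge0 => x _.
- by move/measurable_EFinP : mgf => mgf; apply/measurable_EFinP; exact: measurableT_comp.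
- by apply: filterS fg => x fgx Ox /=; rewrite ger0_norm// subr_ge0 fgx.
Qed.

Lemma L2norm_le_ae f g : L2 f -> L2 g ->
  {ae vol, forall x, Omega x -> `|f x| <= `|g x|} -> nrm f <= nrm g.
Proof.
move=> Lf Lg fg; rewrite !L2norm_sqrt ler_wsqrtr// !ipE.
apply: le_ae_Rintegral; [exact: L2_integrable|exact: L2_integrable|].
by apply: filterS fg => x fgx /fgx {}fgx; rewrite -!expr2 -ler_sqrt ?sqr_ge0// !sqrtr_sqr.
Qed.

Lemma L2norm_eq0_ae f : L2 f -> nrm f = 0 ->
  {ae vol, forall x, Omega x -> f x = 0}.
Proof.
move=> Lf f0; have fi := L2_integrable Lf Lf.
have : (\int[vol]_(x in Omega) `|(f x * f x)%:E| = 0)%E.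
  under eq_integral do rewrite -expr2 gee0_abs ?lee_fin ?sqr_ge0// expr2.
  rewrite -[LHS]fineK; last exact: (integrable_fin_num mO fi).
  by rewrite -/(Rintegral _ _ _) -ipE -L2normE f0 expr0n.
move=> /(ae_eq_integral_abs vol mO (measurable_int _ fi)).
apply: filterS => x /= + Ox => /(_ Ox) [/eqP].
by rewrite mulf_eq0 orbb => /eqP.
Qed.

Lemma ip_cvg (T : Type) (F : set_system T) {FF : Filter F} (f_ : T -> X -> R) f g :
  (forall n, L2 (f_ n)) -> L2 f -> L2 g ->
  L2dist Omega (f_ n) f @[n --> F] --> (0 : R) -> ip (f_ n) g @[n --> F] --> ip f g.
Proof.
move=> Lf_ Lf Lg f_f.
have H : L2dist Omega (f_ n) f * nrm g @[n --> F] --> (0 : R).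
  by rewrite -(mul0r (nrm g)); exact: cvgMl.
apply/cvgrPdist_le => e e0.
have /cvgrPdist_le/(_ _ e0) := H; apply: filterS => n.
rewrite sub0r normrN; apply: le_trans; rewrite distrC -ipBl//.
apply: le_trans (ler_norm _); apply: cauchy_schwarz => //; exact: L2B.
Qed.

End L2_space.

(** * Integration by parts and the energy *)

Section sobolev_space.
Context {R : realType} {d : nat} (Omega : set 'rV[R]_d).
Local Notation X := 'rV[R]_d.
Local Notation vol := (lebesgue_rV (R := R) d).
Local Notation L2 := (L2 Omega).
Local Notation nrm := (L2norm Omega).
Local Notation ip := (ip Omega).
Local Notation wp := (wpartial Omega).
Local Notation Lap := (laplacian Omega).
Implicit Types (f g h v w : X -> R) (k : R).
Hypotheses (mO : measurable Omega) (bO : bounded_set Omega).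

Lemma wpartialP i f : H1 Omega f -> L2 (wp i f) /\ weak_partial Omega i f (wp i f).
Proof. by move=> [_ /(_ i) h]; exact: (xgetPex _ h). Qed.

Lemma test_function_L2 phi : test_function Omega phi ->
  L2 phi /\ forall i, L2 (partial i phi).
Proof.
move=> [Cphi _ _]; split; first exact/continuous_L2/(Cphi 0%N).
by move=> i; have [_ /(_ i)[_ [c _]]] := Cphi 2%N; exact: continuous_L2.
Qed.

(** The definition of the weak derivative of [wp i g], passed to the limit along
    test functions that approximate [f]. *)
Lemma H10_by_parts i f g : H10 Omega f -> H1 Omega g -> H1 Omega (wp i g) ->
  ip (wp i f) (wp i g) = - ip f (wp i (wp i g)).
Proof.
move=> [Hf [phi [tphi phif dphif]]] Hg Hdg.
have [Lddg wddg] := wpartialP i Hdg.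
have [Ldf _] := wpartialP i Hf.
have Lphi n := (test_function_L2 (tphi n)).1.
have Ldphi n := (test_function_L2 (tphi n)).2 i.
have c1 := ip_cvg mO Lphi Hf.1 Lddg phif.
have c2 := ip_cvg mO Ldphi Ldf Hdg.1 (dphif i).
have E n : ip (partial i (phi n)) (wp i g) = - ip (phi n) (wp i (wp i g)).
  by rewrite ipC [in RHS]ipC !ipE; exact: wddg.
have c3 : ip (partial i (phi n)) (wp i g) @[n --> \oo] --> - ip f (wp i (wp i g)).
  by under eq_fun do rewrite E; exact: (cvgN (c1 _)).
exact: (cvg_unique (@Rhausdorff R) (c2 _) c3).
Qed.

Lemma L2_laplacian f : H2 Omega f -> L2 (Lap f).
Proof.
by move=> [_ Hf]; apply: L2_sum => i; exact: (wpartialP i (Hf i)).1.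
Qed.

Lemma H10_H2_by_parts f g : H10 Omega f -> H2 Omega g ->
  \sum_(i < d) ip (wp i f) (wp i g) = - ip f (Lap g).
Proof.
move=> f0 [Hg Hdg].
rewrite ipC ip_suml//; last 2 first.
- by move=> i; exact: (wpartialP i (Hdg i)).1.
- exact: f0.1.1.
rewrite -sumrN; apply: eq_bigr => i _.
by rewrite H10_by_parts// [in RHS]ipC.
Qed.

(** Both cross terms [ip (wp i v) (wp i w)] and [ip (wp i w) (wp i v)] are integrated
    by parts, and their difference is 0 by symmetry. Each product is integrated by
    parts on its own, since [wpartial] chooses representatives and is linear only
    almost everywhere. *)
Lemma dirichlet_difference v w : H2_H10 Omega v -> H2_H10 Omega w ->
  \sum_(i < d) ip (wp i v) (wp i v) - \sum_(i < d) ip (wp i w) (wp i w) =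
  - ip (v \- w) (Lap v \+ Lap w).
Proof.
move=> [Hv v0] [Hw w0].
have Lv : L2 v := Hv.1.1. have Lw : L2 w := Hw.1.1.
have LLv := L2_laplacian Hv. have LLw := L2_laplacian Hw.
rewrite ipBl// ?ipDr//; last exact: L2D.
have sym : \sum_(i < d) ip (wp i v) (wp i w) = \sum_(i < d) ip (wp i w) (wp i v).
  by apply: eq_bigr => i _; exact: ipC.
have := H10_H2_by_parts v0 Hw; rewrite sym.
rewrite (H10_H2_by_parts v0 Hv) (H10_H2_by_parts w0 Hw) (H10_H2_by_parts w0 Hv).
generalize (Lap v) (Lap w) => p q; lra.
Qed.

Let ler_diag_sum (a : 'I_d -> 'I_d -> R) i : (forall i j, 0 <= a i j) ->
  a i i <= \sum_(i < d) \sum_(j < d) a i j.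
Proof.
move=> a0; rewrite (bigD1 i)//= (bigD1 i)//= -addrA ler_wpDr// addr_ge0 ?sumr_ge0//.
by move=> j _; exact: sumr_ge0.
Qed.

Lemma L2dist_laplacian v w : H2 Omega v -> H2 Omega w ->
  nrm (Lap v \- Lap w) <= d%:R * H2dist Omega v w.
Proof.
move=> [_ Hv] [_ Hw].
have Lv i := (wpartialP i (Hv i)).1. have Lw i := (wpartialP i (Hw i)).1.
have tri (r : seq 'I_d) (F : 'I_d -> X -> R) : (forall i, L2 (F i)) ->
    nrm (fun x => \sum_(i <- r) F i x) <= \sum_(i <- r) nrm (F i).
  move=> LF; elim: r => [|i r ih].
    rewrite big_nil (_ : (fun x => _) = cst 0) ?L2norm0//.
    by apply/funext => x; rewrite big_nil.
  rewrite big_cons (_ : (fun x => _) = F i \+ (fun x => \sum_(j <- r) F j x)).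
    2: by apply/funext => x; rewrite big_cons.
  by rewrite (le_trans (L2normD mO (LF i) (L2_sum _ LF)))// lerD2l.
have -> : Lap v \- Lap w = fun x => \sum_(i < d) (wp i (wp i v) \- wp i (wp i w)) x.
  by apply/funext => x /=; rewrite /laplacian -sumrB.
apply: le_trans (tri _ _ _) _ => [i|]; first exact: L2B.
have -> : d%:R * H2dist Omega v w = \sum_(i < d) H2dist Omega v w.
  by rewrite sumr_const card_ord mulr_natl.
apply: ler_sum => i _.
rewrite /H2dist -[leLHS]ger0_norm ?L2norm_ge0// -sqrtr_sqr ler_wsqrtr//.
apply: ler_wpDl; first by rewrite addr_ge0 ?sqr_ge0 ?sumr_ge0// => j _; exact: sqr_ge0.
apply: (@ler_diag_sum (fun i j => L2dist Omega (wp j (wp i v)) (wp j (wp i w)) ^+ 2)).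
by move=> j k; exact: sqr_ge0.
Qed.

Section energy.
Variables (M : R).
Hypothesis M0 : 0 <= M.
Definition ae_bounded v := {ae vol, forall x, Omega x -> `|v x| <= M}.

Lemma L2_sqr v : L2 v -> ae_bounded v -> L2 (fun x => v x ^+ 2).
Proof.
move=> Lv bv; have mv := L2_measurable mO Lv.
apply: (L2_dominated mO (k := M) _ Lv); first exact: measurable_funX.
by apply: filterS bv => x bx /bx {}bx; rewrite normrX expr2 ler_wpM2r.
Qed.

Lemma L2_ac_f v : L2 v -> ae_bounded v -> L2 (fun x => ac_f (v x)).
Proof.
move=> Lv bv; have mv := L2_measurable mO Lv.
apply: (L2_dominated mO (k := M ^+ 2 + 1) _ Lv).
  by apply: measurable_funB => //; exact: measurable_funX.
apply: filterS bv => x bx /bx {}bx.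
rewrite /ac_f (_ : _ - _ = (v x ^+ 2 - 1) * v x); last by ring.
rewrite normrM ler_wpM2r// (le_trans (ler_normB _ _))// normr1 lerD2r.
by rewrite normrX lerXn2r ?nnegrE.
Qed.

Lemma L2norm_ac_f v : L2 v -> ae_bounded v ->
  nrm (fun x => ac_f (v x)) <= (M ^+ 2 + 1) * nrm v.
Proof.
move=> Lv bv; have k0 : 0 <= M ^+ 2 + 1 by rewrite addr_ge0// sqr_ge0.
rewrite -[M ^+ 2 + 1]ger0_norm// -L2normZ//.
apply: L2norm_le_ae; [by []|exact: L2_ac_f|exact: L2Z|].
apply: filterS bv => x bx /bx {}bx.
rewrite /ac_f (_ : _ - _ = (v x ^+ 2 - 1) * v x); last by ring.
rewrite !normrM ler_wpM2r// (ger0_norm k0).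
rewrite (le_trans (ler_normB _ _))// normr1 lerD2r.
by rewrite normrX lerXn2r ?nnegrE.
Qed.

Let W v x : R := 4^-1 * (v x ^+ 2 - 1) ^+ 2.

Lemma integrable_double_well v : L2 v -> ae_bounded v ->
  vol.-integrable Omega (EFin \o W v).
Proof.
move=> Lv bv.
have L : L2 (fun x => v x ^+ 2 - 1).
  apply: (@L2B _ _ _ (fun x => v x ^+ 2) (cst 1) (L2_sqr Lv bv)).
  apply: continuous_L2 => //.
  exact: cst_continuous.
apply: (eq_integrable mO _ _ _ (L2_integrable mO (L2Z 4^-1 L) L)) => x _.
by rewrite /W/=; congr EFin; ring.
Qed.

Lemma energyE eps u t : H1 Omega (u t) -> ae_bounded (u t) ->
  energy Omega eps u t = eps ^+ 2 / 2 * \sum_(i < d) ip (wp i (u t)) (wp i (u t)) +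
    \int[vol]_(x in Omega) W (u t) x.
Proof.
move=> Hu bu.
have Li i : L2 (wp i (u t)) := (wpartialP i Hu).1.
have Ii i := L2_integrable mO (Li i) (Li i).
have S : vol.-integrable Omega (EFin \o (fun x => \sum_(i < d) wp i (u t) x ^+ 2)).
  apply: (eq_integrable mO _ _ _ (integrable_sum mO (index_enum 'I_d)
    (P := xpredT) (fun i _ => Ii i))) => x _.
  by rewrite /= sumEFin; congr EFin; apply: eq_bigr => i _; rewrite expr2.
rewrite /energy RintegralD//; last 2 first.
- exact: (integrableZl mO _ S).
- exact: integrable_double_well Hu.1 bu.
congr (_ + _); rewrite RintegralZl//; congr (_ * _).
rewrite /Rintegral; under eq_integral do rewrite -sumEFin.
rewrite integral_sum//.
transitivity (\sum_(i < d) fine (\int[vol]_(x in Omega) (wp i (u t) x ^+ 2)%:E)%E).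
  rewrite sum_fine// => i _; apply: integrable_fin_num => //.
  by apply: (eq_integrable mO _ _ _ (Ii i)) => x _; rewrite /= expr2.
by apply: eq_bigr => i _; rewrite ipE; congr fine; apply: eq_integral => x _; rewrite expr2.
Qed.

(** [W a - W b - W' b * (a - b)] is [(a - b) ^ 2] times a quadratic form in
    [a] and [b], at most [3 M ^ 2 / 2] on bounded functions. *)
Lemma double_well_difference v w : L2 v -> ae_bounded v -> L2 w -> ae_bounded w ->
  \int[vol]_(x in Omega) W v x - \int[vol]_(x in Omega) W w x <=
  ip (v \- w) (fun x => ac_f (w x)) + 3 / 2 * M ^+ 2 * nrm (v \- w) ^+ 2.
Proof.
move=> Lv bv Lw bw.
have Lvw := L2B Lv Lw. have Lf := L2_ac_f Lw bw.
rewrite L2normE -ipZr// -ipDr//; last exact: L2Z.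
rewrite -RintegralB//; try exact: integrable_double_well.
rewrite ipE; apply: le_ae_Rintegral => //.
- exact: (integrableB mO (integrable_double_well Lv bv) (integrable_double_well Lw bw)).
- by apply: L2_integrable => //; apply: L2D => //; exact: L2Z.
apply: filterS2 bv bw => x bv bw Ox; move: (bv Ox) (bw Ox) => {bv bw}.
rewrite /W /ac_f/= !ler_norml; move: (v x) (w x) => a b /andP[a1 a2] /andP[b1 b2].
have P c e : `|c| <= M -> `|e| <= M -> c * e <= M ^+ 2.
  move=> cM eM; rewrite (le_trans (ler_norm _))// normrM expr2.
  exact: ler_pM.
have aM : `|a| <= M by rewrite ler_norml a1.
have bM : `|b| <= M by rewrite ler_norml b1.
have : 0 <= (a - b) ^+ 2 * (6 * M ^+ 2 - (a * a + 2 * (a * b) + 3 * (b * b))).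
  rewrite mulr_ge0 ?sqr_ge0//.
  have := P a a aM aM; have := P a b aM bM; have := P b b bM bM; lra.
have : 0 <= (a - b) ^+ 2 by exact: sqr_ge0.
lra.
Qed.

Lemma energy_difference eps u s t :
  H2_H10 Omega (u s) -> ae_bounded (u s) ->
  H2_H10 Omega (u t) -> ae_bounded (u t) ->
  energy Omega eps u s - energy Omega eps u t <=
  - (eps ^+ 2 / 2) * ip (u s \- u t) (Lap (u s) \+ Lap (u t)) +
  ip (u s \- u t) (fun x => ac_f (u t x)) +
  3 / 2 * M ^+ 2 * nrm (u s \- u t) ^+ 2.
Proof.
move=> Hs bs Ht bt; rewrite !energyE//; [|exact: Ht.1.1|exact: Hs.1.1].
have := dirichlet_difference Hs Ht.
have := double_well_difference Hs.1.1.1 bs Ht.1.1.1 bt.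
set A := \sum_(_ < _) _; set B := \sum_(_ < _) _.
set I := ip _ _; set J := ip _ _.
move=> + E; rewrite (_ : A = B - J); last by lra.
lra.
Qed.

End energy.

End sobolev_space.

(** * Bochner integrals against a fixed function *)

Section bochner_pairing.
Context {R : realType} {d : nat} (Omega : set 'rV[R]_d).
Local Notation X := 'rV[R]_d.
Local Notation leb := (@lebesgue_measure R).
Local Notation L2 := (L2 Omega).
Local Notation nrm := (L2norm Omega).
Local Notation dist := (L2dist Omega).
Local Notation ip := (ip Omega).
Variables (D : set R) (phi : X -> R).
Hypotheses (mO : measurable Omega) (mD : measurable (D : set (measurableTypeR R))) (Lphi : L2 phi).

Lemma simple_pairing (s : seq (set R * (X -> R))) : simple_in L2 D s ->
  [/\ L2 (simple_int D s), forall t, L2 (simple_val s t),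
      leb.-integrable D (EFin \o (fun t => ip phi (simple_val s t))) &
      \int[leb]_(t in D) ip phi (simple_val s t) = ip phi (simple_int D s)].
Proof.
elim: s => [_|p s ih Ds].
  have v0 t : simple_val [::] t = cst (0 : R) :> (X -> R).
    by apply/funext => x; rewrite /simple_val big_nil.
  have i0 : simple_int D [::] = cst (0 : R) :> (X -> R).
    by apply/funext => x; rewrite /simple_int big_nil.
  have E : (fun t => ip phi (simple_val [::] t)) = cst 0.
    by apply/funext => t; rewrite v0 ipC ip0l.
  split.
  - by rewrite i0; exact: L2_0.
  - by move=> t; rewrite v0; exact: L2_0.
  - by rewrite E; exact: integrable0.
  - by rewrite E i0 Rintegral_cst// mul0r ipC ip0l.
have Ds' : simple_in L2 D s by move=> q qs; apply: Ds; rewrite inE qs orbT.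
have [Li Lv Iv E] := ih Ds'.
have [mp finp Lp] : [/\ measurable p.1, (leb (p.1 `&` D) < +oo)%E & L2 p.2].
  by apply: Ds; rewrite mem_head.
have vE t : simple_val (p :: s) t = (fun x => \1_(p.1) t * p.2 x) \+ simple_val s t.
  by apply/funext => x; rewrite /simple_val big_cons.
have iE : simple_int D (p :: s) =
    (fun x => fine (leb (p.1 `&` D)) * p.2 x) \+ simple_int D s.
  by apply/funext => x; rewrite /simple_int big_cons.
have ipv t : ip phi (simple_val (p :: s) t) =
    ip phi p.2 * \1_(p.1) t + ip phi (simple_val s t).
  by rewrite vE ipDr// ?ipZr// ?[_ * \1_ _ _]mulrC//; exact: L2Z.
have I1 : leb.-integrable D (EFin \o (\1_(p.1) : R -> R)).
  apply/integrableP; split; first exact/measurable_EFinP.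
  under eq_integral do rewrite /= ger0_norm//.
  by rewrite integral_indic.
have Ip : leb.-integrable D (EFin \o (fun t => ip phi p.2 * \1_(p.1) t)).
  exact: (integrableZl mD _ I1).
have I : leb.-integrable D (EFin \o (fun t => ip phi (simple_val (p :: s) t))).
  by rewrite (funext ipv); exact: (integrableD mD Ip Iv).
split => //.
- by rewrite iE; apply: L2D => //; exact: L2Z.
- by move=> t; rewrite vE; apply: L2D => //; exact: L2Z.
- rewrite (funext ipv) RintegralD// E iE ipDr//; last exact: L2Z.
  congr (_ + _); rewrite RintegralZl// ipZr// mulrC; congr (_ * _).
  by rewrite /Rintegral integral_indic.
Qed.

(** The two sides agree on simple functions, and both depend continuously on [v] for
    the norm of integrable functions of time. *)
Lemma bochner_pairing (v : R -> X -> R) (J : X -> R) :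
  is_bochner_integral L2 dist D v J -> (forall t, D t -> L2 (v t)) ->
  leb.-integrable D (EFin \o (fun t => ip phi (v t))) ->
  \int[leb]_(t in D) ip phi (v t) = ip phi J.
Proof.
move=> [LJ [s [Ds mdist dist0 intJ]]] Lv Iv.
have P n := simple_pairing (Ds n).
have bound e : 0 < e -> `|\int[leb]_(t in D) ip phi (v t) - ip phi J| <=
    nrm phi * e + nrm phi * e.
  move=> e0.
  have e0' : (0 < e%:E)%E by rewrite lte_fin.
  have N1 : \forall n \near \oo,
      (\int[leb]_(t in D) (dist (v t) (simple_val (s n) t))%:E <= e%:E)%E.
    near=> n; apply: ltW; near: n.
    have /= := dist0 [set x | (x < e%:E)%E] _; apply.
    by apply: open_nbhs_nbhs; split; [exact: open_ereal_lt_ereal|].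
  have N2 : \forall n \near \oo, dist (simple_int D (s n)) J <= e.
    have /cvgrPdist_le/(_ _ e0) := intJ; apply: filterS => n.
    by rewrite sub0r normrN ger0_norm ?L2norm_ge0.
  have [n [H1n H2n]] : exists n,
      (\int[leb]_(t in D) (dist (v t) (simple_val (s n) t))%:E <= e%:E)%E /\
      dist (simple_int D (s n)) J <= e.
    by have [n _ H] := filterI N1 N2; exists n; exact: (H n (leqnn n)).
  have [Li Lsv Is Es] := P n.
  rewrite -(subrKA (ip phi (simple_int D (s n)))) (le_trans (ler_normD _ _))//.
  apply: lerD; last first.
    rewrite -ipBr//; apply: le_trans (cauchy_schwarz _ _ _) _ => //; first exact: L2B.
    by rewrite ler_wpM2l ?L2norm_ge0.
  rewrite -Es -RintegralB//.
  have Id : leb.-integrable D (EFin \o (fun t => ip phi (v t) - ip phi (simple_val (s n) t))).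
    exact: (integrableB mD Iv Is).
  apply: le_trans (le_normr_Rintegral mD Id) _.
  rewrite -lee_fin /Rintegral fineK; last first.
    exact: (integrable_fin_num mD (integrable_norm Id)).
  apply: (@le_trans _ _ (\int[leb]_(t in D) ((nrm phi)%:E * (dist (v t) (simple_val (s n) t))%:E)%E)%E).
    apply: ge0_le_integral => //.
    - by case/integrableP : (integrable_norm Id).
    - by apply: measurable_funeM; apply/measurable_EFinP; exact: mdist.
    - move=> t Dt; rewrite -EFinM lee_fin -ipBr//; last exact: Lv.
      by apply: cauchy_schwarz => //; apply: L2B => //; exact: Lv.
  rewrite ge0_integralZl ?lee_fin ?L2norm_ge0//.
  - by rewrite EFinM lee_wpmul2l ?lee_fin ?L2norm_ge0.
  - by apply/measurable_EFinP; exact: mdist.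
  - by move=> t _; rewrite lee_fin L2norm_ge0.
apply/eqP; rewrite -subr_eq0 -normr_le0; apply/ler_addgt0Pr => e e0; rewrite add0r.
have N0 := L2norm_ge0 Omega phi.
have n0 : 0 < 2 * nrm phi + 1 by rewrite ltr_wpDl ?mulr_ge0.
have k0 : 0 < e / (2 * nrm phi + 1) by rewrite divr_gt0.
have kE : e / (2 * nrm phi + 1) * (2 * nrm phi + 1) = e by rewrite divfK// gt_eqF.
apply: le_trans (bound _ k0) _; move: (e / _) k0 kE => k k0 kE; lra.
Unshelve. all: by end_near. Qed.

End bochner_pairing.

(** * The history of a trajectory *)

Section trajectory.
Context {R : realType} {d : nat} (Omega : set 'rV[R]_d).
Local Notation X := 'rV[R]_d.
Local Notation leb := (@lebesgue_measure R).
Local Notation L2 := (L2 Omega).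
Local Notation nrm := (L2norm Omega).
Local Notation dist := (L2dist Omega).
Local Notation ip := (ip Omega).
Variables (alpha T C K : R) (u ut : R -> X -> R).
Implicit Types (phi : X -> R) (a b r s t h : R).
Hypotheses (mO : measurable Omega).
Hypotheses (alpha_gt0 : 0 < alpha) (alpha_lt1 : alpha < 1).
Hypotheses (C_ge0 : 0 <= C) (K_ge0 : 0 <= K).
Hypothesis Lu : forall t, 0 <= t <= T -> L2 (u t).
Hypothesis hoelder_u : forall s t, 0 <= s <= T -> 0 <= t <= T ->
  dist (u t) (u s) <= C * `|t - s| `^ alpha.
Hypothesis ut_derivative : forall t, 0 < t <= T ->
  is_time_derivative Omega `[0, T] u t (ut t).
Hypothesis ut_continuous : continuous_in L2 dist `]0, T] ut.
Hypothesis ut_bound : forall t, 0 < t <= T -> nrm (ut t) <= K * t `^ (alpha - 1).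

Lemma L2_ut t : 0 < t <= T -> L2 (ut t).
Proof. by move=> /ut_derivative[]. Qed.

Lemma is_derive_ip phi t : L2 phi -> 0 < t < T ->
  is_derive t 1 (fun s => ip phi (u s)) (ip phi (ut t)).
Proof.
move=> Lphi /andP[t0 tT].
have tT' : 0 < t <= T by rewrite t0 ltW.
have Lt : L2 (u t) by apply: Lu; rewrite !ltW.
have [Lut_ der] := ut_derivative tT'.
suff H : h^-1 *: (((fun s => ip phi (u s)) \o shift t) (h *: 1) - ip phi (u t))
    @[h --> 0^'] --> ip phi (ut t).
  by apply: DeriveDef; [exact: cvgP H|exact: cvg_lim H].
have n1 : 0 < nrm phi + 1 by rewrite ltr_wpDl ?L2norm_ge0.
apply/cvgrPdist_le => e e0.
have e'0 : 0 < e / (nrm phi + 1) by rewrite divr_gt0.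
have /cvgrPdist_le/(_ _ e'0) := der; rewrite near_withinE => -[r /= r0 Hr].
exists (Num.min r (Num.min t (T - t))) => /=.
  by rewrite !lt_min r0 t0 subr_gt0.
move=> h /=; rewrite sub0r normrN !lt_min => /and3P[hr ht hT] h0.
have /andP[h1 h2] : - t < h < t by rewrite -ltr_norml.
have /andP[h3 h4] : - (T - t) < h < T - t by rewrite -ltr_norml.
have sT : 0 <= h + t <= T by apply/andP; split; lra.
have Ls := Lu sT.
have := Hr (h + t); rewrite /= opprD addrCA subrr addr0 normrN => /(_ hr).
rewrite in_itv/= sT sub0r normrN ger0_norm ?L2norm_ge0// => H.
have {}H : dist (fun x => (u (h + t) x - u t x) / h) (ut t) <= e / (nrm phi + 1).
  move: H; rewrite !addrK; apply; split => //.
  by move=> /(congr1 (fun x => x - t)); rewrite addrK subrr => /eqP; rewrite (negbTE h0).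
have LQ : L2 (fun x => (u (h + t) x - u t x) / h).
  by have := L2Z h^-1 (L2B Ls Lt); under eq_fun do rewrite mulrC.
have -> : h^-1 *: (((fun s => ip phi (u s)) \o shift t) (h *: 1) - ip phi (u t)) =
    ip phi (fun x => (u (h + t) x - u t x) / h).
  have -> : (fun x => (u (h + t) x - u t x) / h) =
      (fun x => h^-1 * ((u (h + t) \- u t) x)) by apply/funext => x; rewrite /= mulrC.
  rewrite ipZr//; last exact: L2B.
  by rewrite ipBr// /= /shift/= [h *: 1]mulr1.
rewrite distrC -ipBr//.
apply: le_trans (cauchy_schwarz _ _ _) _ => //; first exact: L2B.
apply: le_trans (ler_wpM2l (L2norm_ge0 _ _) H) _.
rewrite mulrCA; apply: ler_piMr; first exact: ltW.
by rewrite ler_pdivrMr// mul1r lerDl.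
Qed.

(** Hoelder continuity of exponent [alpha], as a criterion for the continuity of
    functions of time built from [u]. *)
Lemma hoelder_within_continuous (g : R -> R) c a b : 0 <= a -> b <= T ->
  (forall s t, 0 <= s <= T -> 0 <= t <= T -> `|g t - g s| <= c * dist (u t) (u s)) ->
  {within `[a, b], continuous g}.
Proof.
move=> a0 bT H; apply/subspace_continuousP => x /= xab.
have inT y : y \in `[a, b] -> 0 <= y <= T.
  by rewrite in_itv/= => /andP[? ?]; apply/andP; split; lra.
have xT := inT x xab.
apply/cvgrPdist_le => e e0; rewrite near_withinE.
pose k := `|c| * C + 1.
have k0 : 0 < k by rewrite ltr_wpDl ?mulr_ge0.
have ek0 : 0 < e / k by rewrite divr_gt0.
exists ((e / k) `^ alpha^-1) => /=; first by rewrite powR_gt0.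
move=> y /= xy yab; have yT := inT y yab.
rewrite (le_trans (H _ _ yT xT))//.
apply: (@le_trans _ _ (`|c| * (C * (e / k)))).
  apply: (@le_trans _ _ (`|c| * dist (u x) (u y))).
    by rewrite ler_wpM2r ?L2norm_ge0 ?ler_norm.
  rewrite ler_wpM2l// (le_trans (hoelder_u yT xT))// ler_wpM2l//.
  have -> : e / k = ((e / k) `^ alpha^-1) `^ alpha.
    by rewrite -powRrM mulVf ?gt_eqF// powRr1// ltW.
  by apply: ge0_ler_powR; rewrite ?nnegrE ?powR_ge0//; exact: ltW.
have kE : e / k * k = e by rewrite divfK// gt_eqF.
by move: (e / k) ek0 kE; rewrite /k => z; lra.
Qed.

Lemma ip_u_continuous phi a b : L2 phi -> 0 <= a -> b <= T ->
  {within `[a, b], continuous (fun s => ip phi (u s))}.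
Proof.
move=> Lphi a0 bT; apply: (hoelder_within_continuous (c := nrm phi)) => // s t sT tT.
rewrite -ipBr//; [|exact: Lu|exact: Lu].
by apply: cauchy_schwarz => //; apply: L2B; exact: Lu.
Qed.

Lemma dist_u_continuous t a b : 0 <= t <= T -> 0 <= a -> b <= T ->
  {within `[a, b], continuous (fun s => nrm (u t \- u s))}.
Proof.
move=> tT a0 bT; apply: (hoelder_within_continuous (c := 1)) => // r s rT sT.
have Lt := Lu tT; have Lr := Lu rT; have Ls := Lu sT.
have := L2dist_triangle mO Lt Lr Ls; have := L2dist_triangle mO Lt Ls Lr.
rewrite mul1r ler_norml (L2dist_sym _ (u r)) /L2dist.
by move=> ? ?; apply/andP; split; lra.
Qed.

Lemma ip_ut_continuous phi t : L2 phi -> 0 < t < T ->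
  {for t, continuous (fun s => ip phi (ut s))}.
Proof.
move=> Lphi /andP[t0 tT].
have tT' : t \in `]0, T] by rewrite in_itv/= t0 ltW.
have [Lt cvgt] := ut_continuous tT'.
apply/cvgrPdist_le => e e0.
have n1 : 0 < nrm phi + 1 by rewrite ltr_wpDl ?L2norm_ge0.
have e'0 : 0 < e / (nrm phi + 1) by rewrite divr_gt0.
have /cvgrPdist_le/(_ _ e'0) := cvgt; rewrite near_withinE => -[r /= r0 Hr].
exists (Num.min r (Num.min t (T - t))) => /=.
  by rewrite !lt_min r0 t0 subr_gt0.
move=> s /=; rewrite !lt_min => /and3P[hr ht hT].
have /andP[h1 h2] : - t < t - s < t by rewrite -ltr_norml.
have /andP[h3 h4] : - (T - t) < t - s < T - t by rewrite -ltr_norml.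
have sT : 0 < s <= T by apply/andP; split; lra.
have := Hr s hr; rewrite in_itv/= => /(_ sT).
rewrite sub0r normrN ger0_norm ?L2norm_ge0// => H.
have Ls := L2_ut sT.
rewrite distrC -ipBr//.
apply: le_trans (cauchy_schwarz _ _ _) _ => //; first exact: L2B.
apply: le_trans (ler_wpM2l (L2norm_ge0 _ _) H) _.
rewrite mulrCA; apply: ler_piMr; first exact: ltW.
by rewrite ler_pdivrMr// mul1r lerDl.
Qed.

(** The mean value theorem for the scalar function [ip (u t - u s) (u _)]. *)
Lemma lipschitz_u a s t : 0 < a -> a <= s -> s <= t -> t <= T ->
  nrm (u t \- u s) <= K * a `^ (alpha - 1) * (t - s).
Proof.
move=> a0 as_ st tT.
have B0 : 0 <= K * a `^ (alpha - 1) by rewrite mulr_ge0 ?powR_ge0.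
have sT : 0 <= s <= T by apply/andP; split; lra.
have tT' : 0 <= t <= T by apply/andP; split; lra.
have Ls := Lu sT; have Lt := Lu tT'.
have Ld : L2 (u t \- u s) by exact: L2B.
have [->|d0] := eqVneq (nrm (u t \- u s)) 0.
  by rewrite mulr_ge0// subr_ge0.
have {}d0 : 0 < nrm (u t \- u s) by rewrite lt_neqAle eq_sym d0 L2norm_ge0.
rewrite -(ler_pM2l d0) -expr2 L2normE ipBr//.
have [||c cst ->] := MVT_segment st
    (f := fun r => ip (u t \- u s) (u r)) (df := fun r => ip (u t \- u s) (ut r)).
- move=> r; rewrite in_itv/= => /andP[sr rt]; apply: is_derive_ip => //.
  by apply/andP; split; lra.
- by apply: ip_u_continuous => //; lra.
move: cst; rewrite in_itv/= => /andP[sc ct].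
have cT : 0 < c <= T by apply/andP; split; lra.
rewrite mulrA ler_wpM2r ?subr_ge0//.
apply: le_trans (ler_ip mO Ld (L2_ut cT)) _.
rewrite ler_wpM2l ?L2norm_ge0// (le_trans (ut_bound cT))// ler_wpM2l//.
by apply: powR_noninc => //; [rewrite subr_le0 ltW|exact: le_trans sc].
Qed.

Let mitv (i : interval R) : measurable ([set` i] : set (measurableTypeR R)).
Proof. exact: measurable_itv. Qed.

Let measurable_within (a b : R) (g : R -> R) :
  {within `[a, b], continuous g} -> measurable_fun `]a, b[ g.
Proof.
move=> cg; apply: (@measurable_funS _ _ _ _ `[a, b]%classic) => //.
  by move=> x /=; exact: subset_itv_oo_cc.
by apply: subspace_continuous_measurable_fun.
Qed.

Let measurable_powRB (D : set R) (t p : R) :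
  measurable_fun D (fun x : R => (t - x) `^ p).
Proof.
apply: (@measurableT_comp _ _ _ _ _ _ (fun x : R => x `^ p)) => //.
exact: measurable_funB.
Qed.

Let integrable_powRDB_M (t h c : R) (g : R -> R) : 0 < t -> 0 < h ->
  measurable_fun `]0, t[ g -> (forall x : R, 0 < x < t -> `|g x| <= c) ->
  leb.-integrable `]0, t[ (fun x => ((t + h - x) `^ (- alpha - 1) * g x)%:E).
Proof.
move=> t0 h0 mg gc.
have na : - alpha < 0 by rewrite oppr_lt0.
have ik := integrable_powRDB t0 h0 na.
apply: (le_integrable _ _ _ (@integrableZl _ _ _ leb _ _ c _ ik)) => //.
  by apply/measurable_EFinP/measurable_funM => //; exact: measurable_powRB.
move=> x; rewrite /= in_itv/= => /gc gxc.
rewrite lee_fin normrM normrM mulrC ler_wpM2r// (le_trans gxc)// ler_norm//.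
Qed.

Lemma dist_u_le s t : 0 <= s <= T -> 0 <= t <= T ->
  nrm (u t \- u s) <= C * T `^ alpha.
Proof.
move=> sT tT; apply: le_trans (hoelder_u sT tT) _; rewrite ler_wpM2l//.
move: sT tT => /andP[s0 sT] /andP[t0 tT].
apply: ge0_ler_powR; rewrite ?nnegrE ?(ltW alpha_gt0)//; first exact: le_trans tT.
by rewrite ler_norml; apply/andP; split; lra.
Qed.

Lemma history_integrand_le t (x : R) : 0 < x < t -> t <= T ->
  nrm (u t \- u x) ^+ 2 * (t - x) `^ (- alpha - 1) <=
  C ^+ 2 * (t - x) `^ (alpha - 1).
Proof.
move=> /andP[x0 xt] tT; have tx : 0 < t - x by rewrite subr_gt0.
have -> : alpha - 1 = alpha * 2%:R + (- alpha - 1) by ring.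
rewrite [leRHS](_ : _ = C ^+ 2 * ((t - x) `^ (alpha * 2%:R) * (t - x) `^ (- alpha - 1))).
  2: by rewrite -powRD// (gt_eqF tx) implybT.
rewrite mulrA ler_wpM2r ?powR_ge0// powRrM powR_mulrn ?powR_ge0// -exprMn.
rewrite lerXn2r ?nnegrE ?mulr_ge0 ?L2norm_ge0 ?powR_ge0//.
rewrite -(gtr0_norm tx); apply: hoelder_u; apply/andP; split; lra.
Qed.

Lemma history_integrable t : 0 < t <= T ->
  leb.-integrable `]0, t[
    (fun x => (nrm (u t \- u x) ^+ 2 * (t - x) `^ (- alpha - 1))%:E).
Proof.
move=> /andP[t0 tT].
have ik := integrable_powRB t0 alpha_gt0.
apply: (le_integrable _ _ _ (@integrableZl _ _ _ leb _ _ (C ^+ 2) _ ik)) => //.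
  apply/measurable_EFinP/measurable_funM.
    have tT' : 0 <= t <= T by rewrite (ltW t0).
    apply: measurable_funX; apply: measurable_within.
    exact: (dist_u_continuous tT' (lexx 0) tT).
  exact: measurable_powRB.
move=> x; rewrite /= in_itv/= => xt.
rewrite lee_fin [leLHS]ger0_norm; last by rewrite mulr_ge0 ?powR_ge0 ?sqr_ge0.
exact: le_trans (history_integrand_le xt tT) (ler_norm _).
Qed.

Lemma history_posE t : history_pos Omega alpha u t =
  2^-1 * t `^ (- alpha) * nrm (u t \- u 0) ^+ 2 +
  alpha / 2 * \int[leb]_(x in `]0, t[)
    (nrm (u t \- u x) ^+ 2 * (t - x) `^ (- alpha - 1)).
Proof.
rewrite /history_pos; congr (_ + _).
  by rewrite invfM powRN mulrC.
congr (_ * _); apply: eq_Rintegral => x _.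
by rewrite -powRN opprD.
Qed.

Lemma history_pos_ge0 t : 0 <= history_pos Omega alpha u t.
Proof.
rewrite history_posE; apply: addr_ge0; apply: mulr_ge0.
- by rewrite mulr_ge0 ?powR_ge0 ?invr_ge0.
- exact: sqr_ge0.
- by rewrite divr_ge0// ltW.
- by apply: Rintegral_ge0 => x _; rewrite mulr_ge0 ?powR_ge0 ?sqr_ge0.
Qed.

(** By Hoelder continuity the integrand is at most [C ^+ 2 * (t - x) `^ (alpha - 1)]. *)
Lemma history_pos_le t : 0 < t <= T ->
  history_pos Omega alpha u t <= C ^+ 2 * t `^ alpha.
Proof.
move=> /andP[t0 tT]; rewrite history_posE.
have tT' : 0 < t <= T by rewrite t0.
have ik := integrable_powRB t0 alpha_gt0.
have -> : C ^+ 2 * t `^ alpha = 2^-1 * (C ^+ 2 * t `^ alpha) +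
    alpha / 2 * (C ^+ 2 * (t `^ alpha / alpha)) by field; rewrite gt_eqF.
apply: lerD.
  rewrite -mulrA ler_wpM2l ?invr_ge0 ?ler0n//.
  have H : nrm (u t \- u 0) <= C * t `^ alpha.
    rewrite -{2}(subr0 t) -[t - 0]gtr0_norm ?subr0//.
    have := @hoelder_u 0 t; rewrite subr0; apply; apply/andP; split; lra.
  apply: (@le_trans _ _ (t `^ (- alpha) * (C * t `^ alpha) ^+ 2)).
    rewrite ler_wpM2l ?powR_ge0// lerXn2r ?nnegrE ?L2norm_ge0//.
    by rewrite mulr_ge0 ?powR_ge0.
  rewrite powRN exprMn mulrCA ler_wpM2l ?sqr_ge0// expr2 mulKf//.
  by rewrite gt_eqF// powR_gt0.
rewrite ler_wpM2l ?mulr_ge0 ?invr_ge0 ?ler0n ?(ltW alpha_gt0)//.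
rewrite -Rintegral_powRB// -RintegralZl//; apply: le_Rintegral => //.
- exact: history_integrable.
- exact: (@integrableZl _ _ _ leb _ _ (C ^+ 2) _ ik).
- by move=> x; rewrite /= in_itv/= => xt; exact: history_integrand_le.
Qed.

(** For [h = 0] this would be the product of [phi] with the Marchaud form of the
    Caputo integral, [t `^ (- alpha) (u t - u 0)] plus [alpha] times the integral of
    [(t - x) `^ (- alpha - 1) (u t - u x)]; the shift by [h] removes the singularity
    of the kernel. *)
Definition memory_work t h phi : R :=
  (t + h) `^ (- alpha) * ip phi (u t \- u 0) +
  alpha * \int[leb]_(x in `]0, t[) ((t + h - x) `^ (- alpha - 1) * ip phi (u t \- u x)).

Lemma memory_integrable t h phi : L2 phi -> 0 < t <= T -> 0 < h ->
  leb.-integrable `]0, t[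
    (fun x => ((t + h - x) `^ (- alpha - 1) * ip phi (u t \- u x))%:E).
Proof.
move=> Lphi /andP[t0 tT] h0.
have tT' : 0 <= t <= T by rewrite (ltW t0).
have xT (x : R) : 0 < x < t -> 0 <= x <= T by move=> /andP[? ?]; apply/andP; split; lra.
apply: (@integrable_powRDB_M _ _ (nrm phi * (C * T `^ alpha))) => //.
  apply: measurable_within; apply: (hoelder_within_continuous (c := nrm phi)) => // r s rT sT.
  have Lt := Lu tT'; have Lr := Lu rT; have Ls := Lu sT.
  rewrite -ipBr//; [|exact: L2B|exact: L2B].
  have -> : (u t \- u s) \- (u t \- u r) = u r \- u s by apply/funext => x /=; ring.
  rewrite L2dist_sym; apply: cauchy_schwarz => //; exact: L2B.
move=> x /xT{}xT; apply: le_trans (cauchy_schwarz _ _ _) _ => //.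
  by apply: L2B; exact: Lu.
by rewrite ler_wpM2l ?L2norm_ge0// dist_u_le.
Qed.

(** The last step of [history_step]: [k], [k0] and [kh] are the powers [- alpha] of
    [t + h], [t] and [h]; [n] is the square of the norm of the increment, [N] that of
    [u t - u 0], [c] the product of the two; [A], [A1], [M], [Kh] and [B] are
    integrals. *)
Let history_step_arith (k k0 kh al n N c A A1 M Kh B : R) :
  k * N <= k0 * N -> al / 2 * A <= al / 2 * (A1 + 2 * M + n * Kh) ->
  n * (al * Kh) = n * (kh - k) ->
  2^-1 * k * (N + 2 * c + n) + al / 2 * (A + B) <=
  2^-1 * k0 * N + al / 2 * A1 + (k * c + al * M) + 2^-1 * kh * n + al / 2 * B.
Proof. lra. Qed.

(** Expanding the square of [u (t + h) - u x = (u (t + h) - u t) + (u t - u x)];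
    the kernels decrease, so that the squares of [u t - u x] contribute at most
    what they do at time [t]. *)
Lemma history_step t h : 0 < t -> 0 < h -> t + h <= T ->
  history_pos Omega alpha u (t + h) <= history_pos Omega alpha u t +
    memory_work t h (u (t + h) \- u t) +
    2^-1 * h `^ (- alpha) * nrm (u (t + h) \- u t) ^+ 2 +
    alpha / 2 * \int[leb]_(x in `]t, (t + h)[)
      (nrm (u (t + h) \- u x) ^+ 2 * (t + h - x) `^ (- alpha - 1)).
Proof.
move=> t0 h0 thT; set phi := u (t + h) \- u t.
have tT : 0 <= t <= T by apply/andP; split; lra.
have tT' : 0 < t <= T by apply/andP; split; lra.
have tT'' : t <= T by lra.
have thT' : 0 <= t + h <= T by apply/andP; split; lra.
have zT : 0 <= (0 : R) <= T by apply/andP; split; lra.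
have Lt := Lu tT; have Lth := Lu thT'.
have Lphi : L2 phi by exact: L2B.
have sq (x : R) : 0 <= x <= T -> nrm (u (t + h) \- u x) ^+ 2 =
    nrm (u t \- u x) ^+ 2 + 2 * ip phi (u t \- u x) + nrm phi ^+ 2.
  move=> xT; have Lx := Lu xT; have Ltx : L2 (u t \- u x) by exact: L2B.
  have -> : u (t + h) \- u x = (u t \- u x) \+ phi by apply/funext => y /=; rewrite /phi/=; ring.
  by rewrite (L2norm_sqD mO Ltx Lphi) ipC.
have I2 : leb.-integrable `]0, (t + h)[
    (EFin \o (fun x => nrm (u (t + h) \- u x) ^+ 2 * (t + h - x) `^ (- alpha - 1))).
  by apply: history_integrable; apply/andP; split; lra.
have split_int : \int[leb]_(x in `]0, (t + h)[)
      (nrm (u (t + h) \- u x) ^+ 2 * (t + h - x) `^ (- alpha - 1)) =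
    \int[leb]_(x in `]0, t[)
      (nrm (u (t + h) \- u x) ^+ 2 * (t + h - x) `^ (- alpha - 1)) +
    \int[leb]_(x in `]t, (t + h)[)
      (nrm (u (t + h) \- u x) ^+ 2 * (t + h - x) `^ (- alpha - 1)).
  have I2t : leb.-integrable `]0, t[
      (EFin \o (fun x => nrm (u (t + h) \- u x) ^+ 2 * (t + h - x) `^ (- alpha - 1))).
    by apply: (integrableS _ _ _ I2) => //; apply: subset_itvl; rewrite bnd_simp; lra.
  have := Rintegral_itvB I2 (x := t); rewrite !bnd_simp => <-//; [|exact: ltW|by lra].
  by rewrite [X in _ = X + _](Rintegral_itv_bndo_bndc I2t) [RHS]addrC subrK.
have I1 := history_integrable tT'.
have Im := memory_integrable Lphi tT' h0.
have na : - alpha < 0 by rewrite oppr_lt0.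
have Ik := integrable_powRDB t0 h0 na.
have first_part : \int[leb]_(x in `]0, t[)
      (nrm (u (t + h) \- u x) ^+ 2 * (t + h - x) `^ (- alpha - 1)) <=
    \int[leb]_(x in `]0, t[) (nrm (u t \- u x) ^+ 2 * (t - x) `^ (- alpha - 1)) +
    2 * \int[leb]_(x in `]0, t[) ((t + h - x) `^ (- alpha - 1) * ip phi (u t \- u x)) +
    nrm phi ^+ 2 * \int[leb]_(x in `]0, t[) (t + h - x) `^ (- alpha - 1).
  have Im2 := @integrableZl _ _ _ leb _ (mitv _) 2 _ Im.
  have Ik2 := @integrableZl _ _ _ leb _ (mitv _) (nrm phi ^+ 2) _ Ik.
  have I12 := integrableD (mitv _) I1 Im2.
  have <- : \int[leb]_(x in `]0, t[)
      (nrm (u t \- u x) ^+ 2 * (t - x) `^ (- alpha - 1) +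
       2 * ((t + h - x) `^ (- alpha - 1) * ip phi (u t \- u x)) +
       nrm phi ^+ 2 * (t + h - x) `^ (- alpha - 1)) =
    \int[leb]_(x in `]0, t[) (nrm (u t \- u x) ^+ 2 * (t - x) `^ (- alpha - 1)) +
    2 * \int[leb]_(x in `]0, t[) ((t + h - x) `^ (- alpha - 1) * ip phi (u t \- u x)) +
    nrm phi ^+ 2 * \int[leb]_(x in `]0, t[) (t + h - x) `^ (- alpha - 1).
    by rewrite (RintegralD _ I12 Ik2)// (RintegralD _ I1 Im2)// !RintegralZl.
  apply: le_Rintegral => //.
  - by apply: (integrableS _ _ _ I2) => //; apply: subset_itvl; rewrite bnd_simp; lra.
  - exact: (integrableD _ I12 Ik2).
  move=> x; rewrite /= in_itv/= => /andP[x0 xt].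
  have xT : 0 <= x <= T by apply/andP; split; lra.
  have := powR_ge0 (t + h - x) (- alpha - 1).
  have : (t + h - x) `^ (- alpha - 1) <= (t - x) `^ (- alpha - 1).
    have na1 : - alpha - 1 <= 0 by lra.
    have tx : 0 < t - x by lra.
    by apply: (powR_noninc na1 tx); lra.
  rewrite sq//; have := sqr_ge0 (nrm (u t \- u x)); nra.
have kern := Rintegral_powRDB t0 h0 na; rewrite opprK in kern.
rewrite !history_posE split_int (sq _ zT) /memory_work.
have t_th : t <= t + h by rewrite lerDl ltW.
have tail := powR_noninc (ltW na) t0 t_th.
have {}tail := ler_wpM2r (sqr_ge0 (nrm (u t \- u 0))) tail.
have a20 : 0 <= alpha / 2 by rewrite divr_ge0// ltW.
have {}first_part := ler_wpM2l a20 first_part.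
have {}kern := congr1 ( *%R (nrm phi ^+ 2)) kern.
exact: history_step_arith tail first_part kern.
Qed.

Let memory_work_arith (k kh al B c I Kh : R) :
  k * c <= k * B -> al * I <= al * (B * Kh) -> B * (al * Kh) = B * (kh - k) ->
  k * c + al * I <= B * kh.
Proof. lra. Qed.

(** The boundary term and the integral of the kernel add up to [h `^ (- alpha)]. *)
Lemma memory_work_le t h phi : L2 phi -> 0 < t <= T -> 0 < h ->
  memory_work t h phi <= nrm phi * (C * T `^ alpha) * h `^ (- alpha).
Proof.
move=> Lphi tT h0; have t0 : 0 < t by case/andP : tT.
have tT' : 0 <= t <= T by case/andP : tT => /ltW -> ->.
have zT : 0 <= (0 : R) <= T by rewrite lexx; case/andP : tT' => /le_trans; exact.
have na : - alpha < 0 by rewrite oppr_lt0.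
have Im := memory_integrable Lphi tT h0.
have Ik := integrable_powRDB t0 h0 na.
set B := nrm phi * (C * T `^ alpha).
have bound (x : R) : 0 <= x <= T -> ip phi (u t \- u x) <= B.
  move=> xT; apply: le_trans (ler_ip mO Lphi (L2B (Lu tT') (Lu xT))) _.
  by rewrite ler_wpM2l ?L2norm_ge0// dist_u_le.
have kern := Rintegral_powRDB t0 h0 na; rewrite opprK in kern.
have {}kern := congr1 ( *%R B) kern.
apply: memory_work_arith kern; first by rewrite ler_wpM2l ?powR_ge0// bound.
rewrite ler_wpM2l ?(ltW alpha_gt0)// -RintegralZl//.
have IkB := @integrableZl _ _ _ leb _ (mitv _) B _ Ik.
apply: (le_Rintegral (mitv _) Im IkB) => x; rewrite /= in_itv/= => /andP[x0 xt].
rewrite mulrC ler_wpM2r ?powR_ge0// bound// (ltW x0)/=.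
by case/andP : tT' => _; apply: le_trans; exact: ltW.
Qed.

(** Since [nrm (ut x) <= K * x `^ (alpha - 1)], a beta integrand dominates. *)
Lemma ut_kernel_integrable t h phi : L2 phi -> 0 < t < T -> 0 <= h ->
  leb.-integrable `]0, t[
    (EFin \o (fun x => (t + h - x) `^ (- alpha) * ip phi (ut x))).
Proof.
move=> Lphi /andP[t0 tT] h0.
have a1 : 0 < alpha <= 1 by rewrite alpha_gt0 ltW.
have b1 : 0 < 1 - alpha <= 1 by rewrite subr_gt0 alpha_lt1 gerBl ltW.
have ib := integrable_beta t0 a1 b1.
have ibK := @integrableZl _ _ _ leb _ (mitv _) (nrm phi * K) _ ib.
have mt : measurable_fun `]0, t[ (fun x => ip phi (ut x)).
  apply: open_continuous_measurable_fun; first exact: interval_open.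
  move=> x; rewrite inE/= in_itv/= => /andP[x0 xt].
  by apply: ip_ut_continuous => //; rewrite x0; exact: lt_trans tT.
apply: (le_integrable (mitv _) _ _ ibK) => //.
  by apply/measurable_EFinP/measurable_funM => //; exact: measurable_powRB.
move=> x; rewrite /= in_itv/= => /andP[x0 xt].
have xT : 0 < x <= T by rewrite x0 ltW// (lt_trans xt).
have tx : 0 < t - x by rewrite subr_gt0.
have b2 : 1 - alpha - 1 = - alpha by ring.
have na : - alpha <= 0 by rewrite oppr_le0 ltW.
rewrite lee_fin b2 normrM ger0_norm ?powR_ge0//.
apply: le_trans (ler_norm _).
apply: (@le_trans _ _ ((t - x) `^ (- alpha) * (nrm phi * (K * x `^ (alpha - 1))))).
  rewrite ler_pM ?powR_ge0//; first by apply: powR_noninc => //; rewrite lerD2r lerDl.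
  apply: le_trans (cauchy_schwarz mO Lphi (L2_ut xT)) _.
  by rewrite ler_wpM2l ?L2norm_ge0// ut_bound.
by rewrite le_eqVlt; apply/orP; left; apply/eqP; ring.
Qed.

(** Integrating by parts moves the derivative from the kernel, which is smooth up to
    time [t], to [u]. *)
Lemma memory_workE t h phi : L2 phi -> 0 < t < T -> 0 < h ->
  memory_work t h phi =
  \int[leb]_(x in `]0, t[) ((t + h - x) `^ (- alpha) * ip phi (ut x)).
Proof.
move=> Lphi tT h0; have [t0 ltT] := andP tT.
have tT' : 0 <= t <= T by rewrite !ltW.
have tT'' : 0 < t <= T by rewrite t0 ltW.
have zT : 0 <= (0 : R) <= T by rewrite lexx (le_trans (ltW t0))// ltW.
have lt_th (x : R) : x <= t -> x < t + h by move=> xt; rewrite (le_lt_trans xt)// ltrDl.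
pose c := ip phi (u t).
pose g (x : R) := ip phi (u x).
have gE (x : R) : 0 <= x <= T -> ip phi (u t \- u x) = c - g x.
  by move=> xT; rewrite ipBr//; exact: Lu.
have xT (x : R) : 0 < x < t -> 0 < x < T.
  by move=> /andP[-> xt]; exact: lt_trans ltT.
have xT' (x : R) : 0 < x < t -> 0 <= x <= T.
  by move=> /xT/andP[? ?]; rewrite !ltW.
pose G (x : R) := (t + h - x) `^ (- alpha) * (g x - c).
pose f (x : R) := (t + h - x) `^ (- alpha) * ip phi (ut x) -
  alpha * ((t + h - x) `^ (- alpha - 1) * (c - g x)).
have dg (x : R) : 0 < x < t -> is_derive x 1 g (ip phi (ut x)).
  by move=> /xT; exact: is_derive_ip.
have cG : {within `[0, t], continuous G}.
  move=> x; apply: cvgM; last first.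
    by apply: cvgB; [apply: (ip_u_continuous Lphi (lexx 0) (ltW ltT))|exact: cvg_cst].
  move: x; apply: continuous_in_subspaceT => x /set_mem.
  by rewrite /= in_itv/= => /andP[_ /lt_th]; exact: powRB_continuous_lt.
have dG (x : R) : 0 < x < t -> is_derive x 1 G (f x).
  move=> xt; have dgx := dg _ xt.
  have dp := is_derive_powRB (- alpha) (lt_th x (ltW (andP xt).2)).
  have -> : G = (fun y => (t + h - y) `^ (- alpha)) * (g - cst c) by [].
  apply: is_derive_eq; rewrite /f subr0 /GRing.scale/= !fctE.
  ring.
have cf (x : R) : 0 < x < t -> {for x, continuous f}.
  move=> xt; have lt_x := lt_th x (ltW (andP xt).2).
  have cgx : {for x, continuous (fun y => c - g y)}.
    apply: cvgB; first exact: cvg_cst.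
    apply/differentiable_continuous/derivable1_diffP.
    by have dgx := dg _ xt; exact: ex_derive.
  apply: cvgB.
    by apply: cvgM; [exact: powRB_continuous_lt|exact/ip_ut_continuous/xT].
  by apply: cvgMr; apply: cvgM; [exact: powRB_continuous_lt|exact: cgx].
have I1 := ut_kernel_integrable Lphi tT (ltW h0).
have Em : {in `]0, t[%classic, (fun x => (t + h - x) `^ (- alpha - 1) * ip phi (u t \- u x))
    =1 (fun x => (t + h - x) `^ (- alpha - 1) * (c - g x))}.
  by move=> x; rewrite inE/= in_itv/= => /xT'/gE ->.
have I2 : leb.-integrable `]0, t[
    (EFin \o (fun x => (t + h - x) `^ (- alpha - 1) * (c - g x))).
  apply: (eq_integrable (mitv _) _ _ _ (memory_integrable Lphi tT'' h0)) => x xt.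
  by rewrite /= Em.
have I2a := @integrableZl _ _ _ leb _ (mitv _) alpha _ I2.
have := Rintegral_FTC_oo t0 cG dG cf (integrableB (mitv _) I1 I2a).
rewrite /f (RintegralB (mitv _) I1 I2a) RintegralZl//.
have -> : G t = 0 by rewrite /G /g /c subrr mulr0.
have -> : G 0 = - ((t + h) `^ (- alpha) * ip phi (u t \- u 0)).
  by rewrite /G subr0 gE// -mulrN opprB.
rewrite sub0r opprK /memory_work => <-.
have -> : \int[leb]_(x in `]0, t[) ((t + h - x) `^ (- alpha - 1) * ip phi (u t \- u x)) =
  \int[leb]_(x in `]0, t[) ((t + h - x) `^ (- alpha - 1) * (c - g x)).
  by apply: eq_Rintegral => x xt; exact: Em.
by rewrite subrK.
Qed.

Lemma caputo_pairing t phi J : L2 phi -> 0 < t < T ->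
  is_bochner_integral L2 dist `]0, t[
    (fun tau x => ut tau x / (t - tau) `^ alpha) J ->
  ip phi J = \int[leb]_(x in `]0, t[) ((t - x) `^ (- alpha) * ip phi (ut x)).
Proof.
move=> Lphi tT bJ; have [t0 ltT] := andP tT.
have I0 := ut_kernel_integrable Lphi tT (lexx 0); rewrite addr0 in I0.
have Lx (x : R) : x \in `]0, t[ -> L2 (ut x).
  by rewrite in_itv/= => /andP[x0 xt]; apply: L2_ut; rewrite x0 (le_trans (ltW xt)) ?ltW.
have vE (x : R) : (fun y => ut x y / (t - x) `^ alpha) =
    (fun y => (t - x) `^ (- alpha) * ut x y).
  by apply/funext => y; rewrite powRN mulrC.
have E : {in `]0, t[%classic, (fun x => (t - x) `^ (- alpha) * ip phi (ut x)) =1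
    (fun x => ip phi (fun y => ut x y / (t - x) `^ alpha))}.
  by move=> x; rewrite inE => xt; rewrite vE ipZr//; exact: Lx.
rewrite -(bochner_pairing mO (mitv _) Lphi bJ).
- by apply: eq_Rintegral => x xt; rewrite E.
- by move=> x xt; rewrite vE; apply: L2Z; exact: Lx.
- by apply: (eq_integrable (mitv _) _ _ _ I0) => x xt; rewrite /= E.
Qed.

(** The limit [h --> 0] in [memory_workE]. The error is uniform in [phi], because
    [shifted_kernel_small] bounds the scalar integral of the norms. *)
Lemma memory_work_limit t (e : R) : 0 < t < T -> 0 < e ->
  exists2 r, 0 < r & forall h, 0 < h < r -> forall phi, L2 phi ->
    memory_work t h phi <=
    \int[leb]_(x in `]0, t[) ((t - x) `^ (- alpha) * ip phi (ut x)) + e * nrm phi.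
Proof.
move=> tT e0; have [t0 ltT] := andP tT.
have K1 : 0 < K + 1 by rewrite ltr_wpDl.
have a01 : 0 < alpha < 1 by rewrite alpha_gt0.
have [r r0 Hr] := shifted_kernel_small t0 a01 (divr_gt0 e0 K1).
exists r => // h hr phi Lphi; have [Ik kle] := Hr h hr; have h0 : 0 < h by case/andP : hr.
rewrite memory_workE//.
have I0 := ut_kernel_integrable Lphi tT (lexx 0); rewrite addr0 in I0.
have Ih := ut_kernel_integrable Lphi tT (ltW h0).
rewrite -lerBlDl -(RintegralB (mitv _) Ih I0).
have Ik' := @integrableZl _ _ _ leb _ (mitv _) (nrm phi * K) _ Ik.
apply: le_trans (le_Rintegral (mitv _) (integrableB (mitv _) Ih I0) Ik' _) _.
  move=> x; rewrite /= in_itv/= => /andP[x0 xt].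
  have xT : 0 < x <= T by rewrite x0 (le_trans (ltW xt)) ?ltW.
  have tx : 0 < t - x by rewrite subr_gt0.
  have na : - alpha <= 0 by rewrite oppr_le0 ltW.
  have k0 : 0 <= (t - x) `^ (- alpha) - (t + h - x) `^ (- alpha).
    by rewrite subr_ge0; apply: powR_noninc => //; rewrite lerD2r lerDl ltW.
  rewrite -mulrBl -opprB mulNr -mulrN mulrCA.
  apply: ler_wpM2l => //.
  apply: (@le_trans _ _ (nrm phi * (K * x `^ (alpha - 1)))); last by rewrite mulrA.
  apply: (@le_trans _ _ `|ip phi (ut x)|); first by rewrite -normrN ler_norm.
  apply: le_trans (cauchy_schwarz mO Lphi (L2_ut xT)) _.
  by rewrite ler_wpM2l ?L2norm_ge0// ut_bound.
rewrite RintegralZl// mulrC [_ * K]mulrC mulrA ler_wpM2r ?L2norm_ge0//.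
apply: le_trans (ler_wpM2r K_ge0 kle) _.
by rewrite mulrAC ler_pdivrMr// ler_wpM2l ?lerDl// ltW.
Qed.

(** Away from time 0 the trajectory is Lipschitz, so that the last two terms of
    [history_step] are of order [h `^ (2 - alpha)]. *)
Lemma history_step_lip a t h : 0 < a -> a <= t -> 0 < h -> t + h <= T ->
  history_pos Omega alpha u (t + h) <= history_pos Omega alpha u t +
    memory_work t h (u (t + h) \- u t) +
    (K * a `^ (alpha - 1)) ^+ 2 * (h `^ (1 - alpha) * h).
Proof.
move=> a0 at_ h0 thT; set L := K * a `^ (alpha - 1).
have t0 : 0 < t := lt_le_trans a0 at_.
have L0 : 0 <= L by rewrite mulr_ge0 ?powR_ge0.
have a1 : 0 <= 1 - alpha by rewrite subr_ge0 ltW.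
have tht : t + h - t = h by rewrite addrC addKr.
have powS (y : R) : 0 < y -> y ^+ 2 * y `^ (- alpha - 1) = y `^ (1 - alpha).
  move=> y0; rewrite -powR_mulrn ?ltW// -powRD; last by rewrite (gt_eqF y0) implybT.
  by congr (_ `^ _); ring.
have lip (x : R) : t <= x -> x < t + h -> nrm (u (t + h) \- u x) ^+ 2 <= (L * (t + h - x)) ^+ 2.
  move=> tx xth; have thx : 0 <= t + h - x by rewrite subr_ge0 ltW.
  apply: lerXn2r; rewrite ?nnegrE ?L2norm_ge0 ?(mulr_ge0 L0 thx)//.
  by apply: lipschitz_u => //; [exact: le_trans tx|exact: ltW].
apply: le_trans (history_step t0 h0 thT) _; rewrite -addrA lerD2l.
have H1 : 2^-1 * h `^ (- alpha) * nrm (u (t + h) \- u t) ^+ 2 <=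
    2^-1 * (L ^+ 2 * (h `^ (1 - alpha) * h)).
  rewrite -mulrA ler_wpM2l// -(powS _ h0).
  have -> : h `^ (- alpha) = h `^ (- alpha - 1) * h.
    rewrite -[X in _ * X]powRr1 ?ltW// -powRD ?(gt_eqF h0) ?implybT//.
    by rewrite subrK.
  have := lip t (lexx _); rewrite ltrDl tht => /(_ h0)/(ler_wpM2l (powR_ge0 h (- alpha - 1))).
  by rewrite exprMn; move: (h `^ (- alpha - 1)) => k /(ler_wpM2r (ltW h0)); lra.
have mI : measurable (`]t, (t + h)[%classic : set (measurableTypeR R)) by exact: measurable_itv.
have H2 : \int[leb]_(x in `]t, (t + h)[)
      (nrm (u (t + h) \- u x) ^+ 2 * (t + h - x) `^ (- alpha - 1)) <=
    L ^+ 2 * (h `^ (1 - alpha) * h).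
  have -> : L ^+ 2 * (h `^ (1 - alpha) * h) =
      \int[leb]_(x in `]t, (t + h)[) (L ^+ 2 * h `^ (1 - alpha)).
    by rewrite Rintegral_cst//= lebesgue_measure_itv/= lte_fin ltrDl h0 -EFinD tht/= mulrA.
  apply: (le_Rintegral mI).
  - apply: (integrableS _ mI _ (history_integrable (t := t + h) _)) => //.
      by move=> x /=; rewrite !in_itv/= => /andP[/(lt_trans t0)-> ->].
    by rewrite thT addr_gt0.
  - apply/integrableP; split; first exact/measurable_EFinP.
    by rewrite integral_cst//= lebesgue_measure_itv/= lte_fin ltrDl h0 -EFinD -EFinM ltry.
  move=> x; rewrite /= in_itv/= => /andP[tx xth].
  have thx : 0 < t + h - x by rewrite subr_gt0.
  apply: le_trans (ler_wpM2r (powR_ge0 _ _) (lip x (ltW tx) xth)) _.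
  rewrite exprMn -mulrA powS// ler_wpM2l ?sqr_ge0//.
  apply: ge0_ler_powR; rewrite ?nnegrE ?(ltW thx) ?(ltW h0)//.
  by rewrite lerBlDr addrC lerD2l ltW.
have H3 : alpha / 2 * (\int[leb]_(x in `]t, (t + h)[)
      (nrm (u (t + h) \- u x) ^+ 2 * (t + h - x) `^ (- alpha - 1))) <=
    2^-1 * (L ^+ 2 * (h `^ (1 - alpha) * h)).
  apply: le_trans (ler_wpM2l _ H2) _; first by rewrite divr_ge0 ?ltW.
  rewrite ler_wpM2r ?mulr_ge0 ?sqr_ge0 ?powR_ge0 ?(ltW h0)//.
  by rewrite ler_pdivrMr// mulVf// ltW.
by apply: le_trans (lerD H1 H3) _; rewrite -mulrDl -[2^-1]mul1r -splitr mul1r.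
Qed.


(** The upper right derivative of the history is at most the product of the
    derivative of [u] with the memory force [J]. *)
Lemma history_dini t J (e : R) : 0 < t < T -> 0 < e ->
  is_bochner_integral L2 dist `]0, t[
    (fun tau x => ut tau x / (t - tau) `^ alpha) J ->
  exists2 r, 0 < r & forall h, 0 < h < r -> t + h <= T ->
    history_pos Omega alpha u (t + h) <= history_pos Omega alpha u t +
      ip (u (t + h) \- u t) J + e * h.
Proof.
move=> tT e0 bJ; have [t0 ltT] := andP tT.
pose L := K * t `^ (alpha - 1).
have L0 : 0 <= L by rewrite mulr_ge0 ?powR_ge0.
have L1 : 0 < L + 1 by rewrite ltr_wpDl.
have e20 : 0 < e / 2 by rewrite divr_gt0.
have [r1 r10 H1] := memory_work_limit tT (divr_gt0 e20 L1).
have a1 : 0 < 1 - alpha by rewrite subr_gt0.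
have [r2 r20 H2] := powR_small a1 (sqr_ge0 L) e20.
exists (Num.min r1 r2); first by rewrite lt_min r10.
move=> h /andP[h0]; rewrite lt_min => /andP[hr1 hr2] thT.
have Lphi : L2 (u (t + h) \- u t).
  by apply: L2B; apply: Lu; rewrite ?thT ?addr_ge0 ?ltW.
apply: le_trans (history_step_lip t0 (lexx t) h0 thT) _.
rewrite -[leLHS]addrA -[leRHS]addrA lerD2l -/L (caputo_pairing Lphi tT bJ).
have M1 := H1 h _ _ Lphi; rewrite h0 hr1 in M1.
have M2 := H2 h _; rewrite h0 hr2 in M2.
have M3 : e / 2 / (L + 1) * nrm (u (t + h) \- u t) <= e / 2 * h.
  have := lipschitz_u t0 (lexx t) _ thT; rewrite lerDl (ltW h0) => /(_ isT).
  rewrite [t + h - t]addrC addKr -/L => H.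
  rewrite mulrAC ler_pdivrMr// -[leRHS]mulrA ler_wpM2l ?(ltW e20)//.
  by rewrite (le_trans H)// mulrC ler_wpM2l ?lerDl// ltW.
have {}M2 := ler_wpM2r (ltW h0) (M2 isT); rewrite -mulrA in M2.
apply: le_trans (lerD (M1 isT) M2) _.
by rewrite -addrA lerD2l [e in leRHS]splitr mulrDl lerD2r.
Qed.

(** Bounding the work of the memory by [memory_work_le] leaves an error of order
    [h `^ (1 - alpha)]. *)
Lemma history_left_lsc (c e : R) : 0 < c <= T -> 0 < e ->
  exists2 r, 0 < r & forall h, 0 < h < r -> 0 < c - h ->
    history_pos Omega alpha u c <= history_pos Omega alpha u (c - h) + e.
Proof.
move=> /andP[c0 cT] e0.
have c20 : 0 < c / 2 by rewrite divr_gt0.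
pose L := K * (c / 2) `^ (alpha - 1).
have L0 : 0 <= L by rewrite mulr_ge0 ?powR_ge0.
have a1 : 0 < 1 - alpha by rewrite subr_gt0.
pose k := L * (C * T `^ alpha) + L ^+ 2 * T.
have T0 : 0 <= T by rewrite ltW// (lt_le_trans c0).
have k0 : 0 <= k by rewrite addr_ge0 ?mulr_ge0 ?sqr_ge0 ?powR_ge0.
have [r r0 Hr] := powR_small a1 k0 e0.
exists (Num.min r (c / 2)); first by rewrite lt_min r0.
move=> h /andP[h0]; rewrite lt_min => /andP[hr hc] ch0.
have ch : c / 2 <= c - h by rewrite lerBrDr -lerBrDl; lra.
have chT : 0 < c - h <= T by rewrite ch0 (le_trans _ cT)// gerBl ltW.
have hT : h <= T by lra.
have Lphi : L2 (u c \- u (c - h)).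
  by apply: L2B; apply: Lu; rewrite ?cT ?(ltW c0)//; case/andP : chT => /ltW -> ->.
have := history_step_lip c20 ch h0; rewrite subrK => /(_ cT)/le_trans; apply.
rewrite -[leLHS]addrA lerD2l -/L.
apply: le_trans (lerD (memory_work_le Lphi chT h0) (lexx _)) _.
apply: le_trans (Hr h _); last by rewrite h0.
rewrite /k mulrDl; apply: lerD.
  have := lipschitz_u c20 ch _ cT; rewrite gerBl (ltW h0) => /(_ isT).
  rewrite subKr -/L => H.
  have B0 : 0 <= C * T `^ alpha by rewrite mulr_ge0 ?powR_ge0.
  apply: le_trans (ler_wpM2r (powR_ge0 _ _) (ler_wpM2r B0 H)) _.
  rewrite powRN.
  have -> : h `^ (1 - alpha) = h / h `^ alpha.
    by rewrite powRB ?powRr1 ?(ltW h0)// (gt_eqF h0) implybT.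
  by rewrite le_eqVlt; apply/orP; left; apply/eqP; ring.
rewrite -mulrA ler_wpM2l ?sqr_ge0// [T * _]mulrC ler_wpM2l ?powR_ge0//.
Qed.

End trajectory.

(** * Essential bounds at all times *)

Section essential_bound.
Context {R : realType} {d : nat} (Omega : set 'rV[R]_d).
Local Notation X := 'rV[R]_d.
Local Notation leb := (@lebesgue_measure R).
Local Notation vol := (lebesgue_rV (R := R) d).
Local Notation L2 := (L2 Omega).
Local Notation dist := (L2dist Omega).
Variables (T : R) (u : R -> X -> R).
Implicit Types (s t M : R).
Hypotheses (mO : measurable Omega) (T_gt0 : 0 < T).

(** Almost every slice of a null set is null. *)
Lemma Linfty_slices : Linfty_space_time Omega T u ->
  exists2 M, 0 <= M & {ae leb, forall t, 0 < t < T -> ae_bounded Omega M (u t)}.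
Proof.
move=> [_ [M [N [mN N0 PN]]]]; exists `|M| => //.
have mphi := measurable_fun_xsection vol mN.
have : (\int[leb]_t `|(vol \o xsection N) t| = 0)%E.
  by rewrite -[RHS]N0; apply: eq_integral => t _; rewrite gee0_abs.
move=> /(ae_eq_integral_abs leb measurableT mphi).
apply: filterS => t /(_ Logic.I) /= vN tT.
exists (xsection N t); split => //; first exact: measurable_xsection.
move=> x /= /not_implyP[Ox uM]; rewrite /xsection/= inE; apply: PN => /= H.
by apply: uM; apply: le_trans (H tT Ox) (ler_norm _).
Qed.

(** A null set contains no interval of positive length. *)
Lemma ae_dense (P : R -> Prop) (t e : R) : {ae leb, forall s, 0 < s < T -> P s} ->
  0 <= t <= T -> 0 < e -> exists s : R, [/\ 0 < s < T, P s & `|t - s| < e].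
Proof.
move=> aeP /andP[t0 tT] e0.
pose a : R := Num.max 0 (t - e); pose b : R := Num.min T (t + e).
have ab : a < b.
  rewrite /a /b gt_max !lt_min T_gt0 (ltr_wpDl t0 e0) ltrBlDr (le_lt_trans tT) ?ltrDl//=.
  by rewrite ltrD2l (lt_trans _ e0)// oppr_lt0.
apply/not_existsP => H; case: aeP => N [mN N0 PN].
have : (lebesgue_measure (`]a, b[%classic : set R) <= lebesgue_measure N)%E.
  apply: le_measure; rewrite ?inE//.
  move=> s /=; rewrite in_itv/= /a /b gt_max lt_min => /andP[/andP[s0 s1] /andP[s2 s3]].
  apply: PN => /= Ps; apply: (H s); split; first by rewrite s0.
    by apply: Ps; rewrite s0.
  by rewrite ltr_norml; apply/andP; split; lra.
rewrite N0 lebesgue_measure_itv/= lte_fin ab -EFinD lee_fin subr_le0.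
by rewrite leNgt ab.
Qed.

(** The excess of [`|u t|] over [M] is at most [`|u t - u s|] when [`|u s|] is at most
    [M], which holds at times [s] as close to [t] as wanted. *)
Lemma Linfty_all_times (alpha C : R) : 0 < alpha -> 0 <= C ->
  (forall t, 0 <= t <= T -> L2 (u t)) ->
  (forall s t, 0 <= s <= T -> 0 <= t <= T -> dist (u t) (u s) <= C * `|t - s| `^ alpha) ->
  Linfty_space_time Omega T u ->
  exists2 M, 0 <= M & forall t, 0 <= t <= T -> ae_bounded Omega M (u t).
Proof.
move=> a0 C0 Lu hu /Linfty_slices[M M0 aeM]; exists M => // t tT.
pose g x := Num.max (`|u t x| - M) 0.
have Lt := Lu t tT; have mt := L2_measurable mO Lt.
have g0 x : 0 <= g x by rewrite le_max lexx orbT.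
have Lg : L2 g.
  apply: (L2_dominated mO (k := 1) _ Lt).
    apply: measurable_maxr => //; apply: measurable_funB => //.
    exact: measurableT_comp.
  apply: nearW => x Ox; rewrite ger0_norm// mul1r ge_max gerBl M0/=.
  exact: normr_ge0.
have gle s : 0 < s < T -> ae_bounded Omega M (u s) -> L2norm Omega g <= C * `|t - s| `^ alpha.
  move=> /andP[s0 sT] bs; have sT' : 0 <= s <= T by rewrite !ltW.
  apply: le_trans (hu s t sT' tT).
  apply: L2norm_le_ae => //; first by apply: L2B => //; exact: Lu.
  apply: filterS bs => x bs /bs {}bs; rewrite ger0_norm// ge_max normr_ge0 andbT.
  rewrite lerBlDr (le_trans _ (lerD (lexx _) bs))//.
  by rewrite -{1}(subrK (u s x) (u t x)) ler_normD.
have gn : L2norm Omega g = 0.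
  apply/eqP; rewrite eq_le L2norm_ge0 andbT; apply/ler_addgt0Pr => e e0; rewrite add0r.
  have [r r0 Hr] := powR_small a0 C0 e0.
  have r20 : 0 < Num.min r T by rewrite lt_min r0.
  have [s [sT bs ts]] := ae_dense aeM tT r20.
  apply: le_trans (gle s sT bs) _.
  have [->|nts] := eqVneq (t - s) 0.
    by rewrite normr0 powR0 ?gt_eqF// mulr0 ltW.
  by apply: Hr; rewrite normr_gt0 nts; move: ts; rewrite lt_min => /andP[].
have := L2norm_eq0_ae mO Lg gn; apply: filterS => x gx Ox.
by have := gx Ox; rewrite /g => /eqP; rewrite eq_le ge_max subr_le0 => /andP[/andP[]].
Qed.

End essential_bound.

(** * Dissipation of the modified energy *)

Section allen_cahn.
Context {R : realType} {d : nat} (Omega : set 'rV[R]_d).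
Local Notation X := 'rV[R]_d.
Local Notation leb := (@lebesgue_measure R).
Local Notation vol := (lebesgue_rV (R := R) d).
Local Notation L2 := (L2 Omega).
Local Notation nrm := (L2norm Omega).
Local Notation dist := (L2dist Omega).
Local Notation ip := (ip Omega).
Local Notation Lap := (laplacian Omega).
Variables (alpha gamma eps T C K M : R) (u ut cu : R -> X -> R).
Implicit Types (e h r s t : R).
Hypotheses (mO : measurable Omega) (bO : bounded_set Omega).
Hypotheses (alpha_gt0 : 0 < alpha) (alpha_lt1 : alpha < 1).
Hypotheses (gamma_gt0 : 0 < gamma) (T_gt0 : 0 < T).
Hypotheses (C_ge0 : 0 <= C) (K_ge0 : 0 <= K) (M_ge0 : 0 <= M).
Hypothesis Lu : forall t, 0 <= t <= T -> L2 (u t).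
Hypothesis hoelder_u : forall s t, 0 <= s <= T -> 0 <= t <= T ->
  dist (u t) (u s) <= C * `|t - s| `^ alpha.
Hypothesis ut_derivative : forall t, 0 < t <= T ->
  is_time_derivative Omega `[0, T] u t (ut t).
Hypothesis ut_continuous : continuous_in L2 dist `]0, T] ut.
Hypothesis ut_bound : forall t, 0 < t <= T -> nrm (ut t) <= K * t `^ (alpha - 1).
Hypothesis u_bounded : forall t, 0 <= t <= T -> ae_bounded Omega M (u t).
Hypothesis u_H2 : continuous_in (H2_H10 Omega) (H2dist Omega) `[0, T] u.
Hypothesis u_caputo : forall t, 0 < t <= T -> is_caputo Omega alpha ut t (cu t).
Hypothesis u_equation : forall t, 0 < t < T ->
  {ae vol, forall x, Omega x ->
    cu t x = gamma * (eps ^+ 2 * Lap (u t) x - ac_f (u t x))}.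

Let Hu t : 0 <= t <= T -> H2_H10 Omega (u t).
Proof. by move=> tT; have [] := @u_H2 t; rewrite ?in_itv. Qed.

Let LLap t : 0 <= t <= T -> L2 (Lap (u t)).
Proof. by move=> /Hu[H _]; exact: L2_laplacian. Qed.

Let Lf t : 0 <= t <= T -> L2 (fun x => ac_f (u t x)).
Proof. by move=> tT; exact: (L2_ac_f mO M_ge0 (Lu tT) (u_bounded tT)). Qed.

Lemma laplacian_continuous t e : 0 <= t <= T -> 0 < e -> exists2 r, 0 < r &
  forall s, 0 <= s <= T -> `|t - s| < r -> nrm (Lap (u s) \- Lap (u t)) <= e.
Proof.
move=> tT e0; have d1 : 0 < d%:R + 1 :> R by rewrite ltr_wpDl.
have ed0 : 0 < e / (d%:R + 1) by rewrite divr_gt0.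
have tI : `[0, T]%classic t by rewrite /= in_itv.
have [_ /cvgrPdist_le/(_ _ ed0)] := u_H2 tI; rewrite near_withinE => -[r /= r0 Hr].
exists r => // s sT ts; have := Hr s ts; rewrite in_itv/= => /(_ sT).
rewrite sub0r normrN => H.
apply: le_trans (L2dist_laplacian mO (Hu sT).1 (Hu tT).1) _.
have {}H := le_trans (ler_norm _) H.
apply: le_trans (ler_wpM2l (ler0n _ d) H) _.
by rewrite mulrC mulrAC ler_pdivrMr// ler_wpM2l ?lerDl// ltW.
Qed.

(** The shape of [energy_difference], with the products bounded by means of [n], the
    norm of the increment. *)
Let energy_arith (E E' k p q f m n B D F : R) :
  E - E' <= - k * (p + q) + f + m * n ^+ 2 ->
  0 <= k -> 0 <= m -> 0 <= n -> n <= B -> - (p + q) <= n * D -> f <= n * F ->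
  E <= E' + n * (k * D + F + m * B).
Proof.
move=> H k0 m0 n0 nB /(ler_wpM2l k0) pqD fF.
have := ler_wpM2l m0 (ler_wpM2l n0 nB); lra.
Qed.

Lemma energy_upper (D N : R) s t : 0 <= s <= T -> 0 <= t <= T ->
  nrm (Lap (u s)) + nrm (Lap (u t)) <= D -> nrm (u t) <= N ->
  energy Omega eps u s <= energy Omega eps u t + nrm (u s \- u t) *
    (eps ^+ 2 / 2 * D + (M ^+ 2 + 1) * N + 3 / 2 * M ^+ 2 * (C * T `^ alpha)).
Proof.
move=> sT tT LD uN.
have Ld : L2 (u s \- u t) by apply: L2B; exact: Lu.
have E := energy_difference mO bO M_ge0 eps (Hu sT) (u_bounded sT) (Hu tT) (u_bounded tT).
rewrite (ipDr mO (LLap sT) (LLap tT) Ld) in E.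
have n0 := L2norm_ge0 Omega (u s \- u t).
apply: (energy_arith E) => //.
- by rewrite divr_ge0 ?sqr_ge0.
- by rewrite mulr_ge0 ?sqr_ge0// divr_ge0.
- exact: (dist_u_le alpha_gt0 C_ge0 hoelder_u tT sT).
- apply: le_trans (ler_norm _) _; rewrite normrN.
  apply: le_trans (ler_normD _ _) _; apply: le_trans (ler_wpM2l n0 LD).
  by rewrite mulrDr; apply: lerD; exact: (cauchy_schwarz mO Ld (LLap _)).
- apply: le_trans (ler_ip mO Ld (Lf tT)) _; rewrite ler_wpM2l//.
  apply: le_trans (L2norm_ac_f mO M_ge0 (Lu tT) (u_bounded tT)) _.
  by rewrite ler_wpM2l// addr_ge0// sqr_ge0.
Qed.

(** Near [t] the factor of the norm of the increment in [energy_upper] stays below a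
    constant [W], and that norm is at most [C * `|s - t| `^ alpha]. *)
Lemma energy_continuous t e : 0 <= t <= T -> 0 < e -> exists2 r, 0 < r &
  forall s, 0 <= s <= T -> `|t - s| < r ->
    energy Omega eps u t <= energy Omega eps u s + e /\
    energy Omega eps u s <= energy Omega eps u t + e.
Proof.
move=> tT e0; have [r1 r10 H1] := laplacian_continuous tT ltr01.
set D0 := nrm (Lap (u t)) in H1 *; set N0 := nrm (u t); set B := C * T `^ alpha.
pose W := eps ^+ 2 / 2 * (2 * D0 + 1) + (M ^+ 2 + 1) * (N0 + B) + 3 / 2 * M ^+ 2 * B.
have B0 : 0 <= B by rewrite mulr_ge0 ?powR_ge0.
have D00 : 0 <= D0 by exact: L2norm_ge0.
have N00 : 0 <= N0 by exact: L2norm_ge0.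
have W0 : 0 <= W.
  rewrite /W; apply: addr_ge0; first apply: addr_ge0.
  - by apply: mulr_ge0; [rewrite divr_ge0// sqr_ge0|rewrite addr_ge0// mulr_ge0].
  - by apply: mulr_ge0; rewrite addr_ge0// sqr_ge0.
  - by apply: mulr_ge0 => //; apply: mulr_ge0; [rewrite divr_ge0|rewrite sqr_ge0].
have [r2 r20 H2] := powR_small alpha_gt0 (mulr_ge0 C_ge0 W0) e0.
exists (Num.min r1 r2); first by rewrite lt_min r10.
move=> s sT; rewrite lt_min => /andP[ts1 ts2].
have Ls := LLap sT; have Lt := LLap tT.
have near_D : nrm (Lap (u s)) <= D0 + 1.
  have -> : Lap (u s) = (Lap (u s) \- Lap (u t)) \+ Lap (u t).
    by apply/funext => x /=; rewrite subrK.
  apply: le_trans (L2normD mO (L2B Ls Lt) Lt) _.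
  by rewrite addrC lerD2l; exact: H1.
have near_N : nrm (u s) <= N0 + B.
  have -> : u s = (u s \- u t) \+ u t by apply/funext => x /=; rewrite subrK.
  apply: le_trans (L2normD mO (L2B (Lu sT) (Lu tT)) (Lu tT)) _.
  by rewrite addrC lerD2l; exact: (dist_u_le alpha_gt0 C_ge0 hoelder_u tT sT).
have small : nrm (u s \- u t) * W <= e.
  have [->|nts] := eqVneq s t.
    have := hoelder_u tT tT; rewrite subrr normr0 powR0 ?gt_eqF// mulr0.
    by move=> /(ler_wpM2r W0)/le_trans; apply; rewrite mul0r ltW.
  apply: le_trans (H2 `|t - s| _); last by rewrite normr_gt0 subr_eq0 eq_sym nts.
  rewrite mulrAC; apply: ler_wpM2r => //.
  by rewrite distrC; exact: hoelder_u.
have D1 : nrm (Lap (u s)) + D0 <= 2 * D0 + 1 by lra.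
split.
  apply: le_trans (energy_upper tT sT _ near_N) _; first by rewrite addrC; exact: D1.
  have -> : nrm (u t \- u s) = nrm (u s \- u t) by exact: L2dist_sym.
  by rewrite -/B -/W lerD2l.
have N1 : nrm (u t) <= N0 + B by rewrite lerDl.
apply: le_trans (energy_upper sT tT D1 N1) _.
by rewrite -/B -/W lerD2l.
Qed.

Let c0 := (gamma * Gamma (1 - alpha))^-1.
(** The modified energy at positive times, where [history] is [history_pos]. *)
Let Phi t := energy Omega eps u t + c0 * history_pos Omega alpha u t.

Let c0_ge0 : 0 <= c0.
Proof.
rewrite invr_ge0 mulr_ge0 ?(ltW gamma_gt0)//.
by apply: Rintegral_ge0 => x _; rewrite mulr_ge0 ?powR_ge0 ?expR_ge0.
Qed.

(** The equation tested against [phi]: [c0] times the memory force [J] is the Caputo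
    derivative divided by [gamma]. *)
Lemma memory_force_pairing t : 0 < t < T -> exists2 J,
  is_bochner_integral L2 dist `]0, t[ (fun tau x => ut tau x / (t - tau) `^ alpha) J &
  forall phi, L2 phi -> c0 * ip phi J =
    eps ^+ 2 * ip phi (Lap (u t)) - ip phi (fun x => ac_f (u t x)).
Proof.
move=> tT; have [t0 ltT] := andP tT.
have tT' : 0 < t <= T by rewrite t0 ltW.
have tT'' : 0 <= t <= T by rewrite !ltW.
have [J [bJ cuE]] := u_caputo tT'; exists J => // phi Lphi.
have LJ : L2 J by case: bJ.
have LL := LLap tT''. have Lft := Lf tT''.
have LeL := L2Z (eps ^+ 2) LL.
have LR := L2B LeL Lft.
have g0 : gamma != 0 by rewrite gt_eqF.
have Lcu : L2 (cu t) by rewrite cuE; exact: L2Z.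
have E : ip phi (cu t) = ip phi (fun x => gamma * ((fun x => eps ^+ 2 * Lap (u t) x) \- (fun x => ac_f (u t x))) x).
  apply: eq_ip => //; [exact: nearW|exact: u_equation|exact: L2Z].
move: E; rewrite (ipZr mO gamma LR Lphi) (ipBr mO LeL Lft Lphi) (ipZr mO _ LL Lphi).
rewrite cuE (ipZr mO _ LJ Lphi) => /(congr1 ( *%R gamma^-1)).
by rewrite mulrA mulKf// /c0 invfM.
Qed.

(** The bookkeeping of [modified_energy_dini] for an increment of norm [n <= L * h]:
    [p] and [q] are its products with the Laplacians at times [t + h] and [t], [f] and
    [J] those with the nonlinearity and the memory force. In the sum of the first two
    inequalities, [c0 * J] cancels [f] and leaves [k * (q - p)]. *)
Let dissipation_arith (E E' H H' k p q f m n J e1 y L h e : R) :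
  E' - E <= - k * (p + q) + f + m * n ^+ 2 ->
  H' <= H + J + e1 * h -> c0 * J = 2 * k * q - f ->
  0 <= k -> 0 <= m -> 0 <= n -> 0 <= h -> n <= L * h ->
  q - p <= n * y ->
  k * (L * y) <= e / 3 -> m * (L * (L * h)) <= e / 3 -> c0 * e1 <= e / 3 -> 0 <= y ->
  0 <= L ->
  E' + c0 * H' <= E + c0 * H + e * h.
Proof.
move=> H1 /(ler_wpM2l c0_ge0) H2 H3 k0 m0 n0 h0 nL qp ky mL ce y0 L0.
have A1 : k * (q - p) <= e / 3 * h.
  apply: le_trans (ler_wpM2l k0 qp) _.
  apply: le_trans (ler_wpM2l k0 (ler_wpM2r y0 nL)) _.
  by have := ler_wpM2r h0 ky; lra.
have A2 : m * n ^+ 2 <= e / 3 * h.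
  have Lh0 : 0 <= L * h by rewrite mulr_ge0.
  apply: (@le_trans _ _ (m * (L * h) ^+ 2)); first by rewrite ler_wpM2l// lerXn2r ?nnegrE.
  by have := ler_wpM2r h0 mL; lra.
have A3 := ler_wpM2r h0 ce.
lra.
Qed.

(** The dissipation inequality: the upper right derivative of the modified energy is
    nonpositive. The equation makes the work of the memory force cancel the derivative
    of the energy. *)
Lemma modified_energy_dini t e : 0 < t < T -> 0 < e -> exists2 r, 0 < r &
  forall h, 0 < h < r -> Phi (t + h) <= Phi t + e * h.
Proof.
move=> tT e0; have [t0 ltT] := andP tT.
have tT' : 0 <= t <= T by rewrite !ltW.
pose L := K * t `^ (alpha - 1).
have L0 : 0 <= L by rewrite mulr_ge0 ?powR_ge0.
pose k := eps ^+ 2 / 2. pose m := 3 / 2 * M ^+ 2.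
have k0 : 0 <= k by rewrite divr_ge0 ?sqr_ge0.
have m0 : 0 <= m by rewrite mulr_ge0 ?sqr_ge0// divr_ge0.
have e30 : 0 < e / 3 by rewrite divr_gt0.
have pos1 (z : R) : 0 <= z -> 0 < z + 1 by move=> z0; rewrite ltr_wpDl.
have quot (z : R) : 0 <= z -> 0 < e / 3 / (z + 1) /\ z * (e / 3 / (z + 1)) <= e / 3.
  move=> z0; have z1 := pos1 _ z0; split; first by rewrite divr_gt0.
  by rewrite mulrCA ler_piMr ?(ltW e30)// ler_pdivrMr// mul1r lerDl.
have [y0 ky] := quot _ (mulr_ge0 k0 L0).
have [hm mL] := quot _ (mulr_ge0 m0 (mulr_ge0 L0 L0)).
have [e10 ce] := quot _ c0_ge0.
have [r1 r10 H1] := laplacian_continuous tT' y0.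
have [J bJ JE] := memory_force_pairing tT.
have [r2 r20 H2] := history_dini mO alpha_gt0 alpha_lt1 C_ge0 K_ge0 Lu hoelder_u
  ut_derivative ut_continuous ut_bound tT e10 bJ.
pose r := Num.min (Num.min r1 r2) (Num.min (e / 3 / (m * (L * L) + 1)) (T - t)).
exists r; first by rewrite !lt_min r10 r20 hm subr_gt0.
move=> h /andP[h0]; rewrite !lt_min => /andP[/andP[hr1 hr2] /andP[hr3 hr4]].
have thT : t + h <= T by rewrite -lerBrDl ltW.
have thT' : 0 <= t + h <= T by rewrite thT addr_ge0 ?ltW.
have Ld : L2 (u (t + h) \- u t) by apply: L2B; exact: Lu.
have E1 := energy_difference mO bO M_ge0 eps (Hu thT') (u_bounded thT') (Hu tT') (u_bounded tT').
rewrite (ipDr mO (LLap thT') (LLap tT') Ld) in E1.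
have E2 := H2 h; rewrite h0 hr2 in E2.
have E3 := JE _ Ld.
have keps : 2 * k = eps ^+ 2 by rewrite /k mulrC divfK.
rewrite -keps in E3.
have n0 := L2norm_ge0 Omega (u (t + h) \- u t).
apply: (dissipation_arith E1 (E2 isT thT) E3 k0 m0 n0 (ltW h0) _ _ _ _ ce (ltW y0) L0).
- have := lipschitz_u mO alpha_gt0 alpha_lt1 C_ge0 K_ge0 Lu hoelder_u ut_derivative
    ut_bound t0 (lexx t) _ thT.
  by rewrite lerDl (ltW h0) [t + h - t]addrC addKr => /(_ isT).
- rewrite -opprB -(ipBr mO (LLap thT') (LLap tT') Ld).
  apply: le_trans (ler_norm _) _; rewrite normrN.
  apply: le_trans (cauchy_schwarz mO Ld (L2B (LLap thT') (LLap tT'))) _.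
  rewrite ler_wpM2l//; apply: H1 => //.
  by rewrite opprD addrA subrr sub0r normrN gtr0_norm.
- by rewrite mulrA.
- apply: le_trans mL; rewrite [L * (L * h)]mulrA mulrA.
  exact: (ler_wpM2l (mulr_ge0 m0 (mulr_ge0 L0 L0)) (ltW hr3)).
Qed.

Lemma modified_energy_left_lsc (c e : R) : 0 < c <= T -> 0 < e -> exists2 r, 0 < r &
  forall h, 0 < h < r -> 0 < c - h -> Phi c <= Phi (c - h) + e.
Proof.
move=> cT e0; have [cpos cleT] := andP cT.
have cT' : 0 <= c <= T by rewrite (ltW cpos).
have e20 : 0 < e / 2 by rewrite divr_gt0.
have c1 : 0 < c0 + 1 by rewrite ltr_wpDl.
have e3 := divr_gt0 e20 c1.
have [r1 r10 H1] := energy_continuous cT' e20.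
have [r2 r20 H2] := history_left_lsc mO alpha_gt0 alpha_lt1 C_ge0 K_ge0 Lu
  hoelder_u ut_derivative ut_bound cT e3.
exists (Num.min r1 r2); first by rewrite lt_min r10.
move=> h /andP[h0]; rewrite lt_min => /andP[hr1 hr2] ch0.
have chT : 0 <= c - h <= T by rewrite (ltW ch0) (le_trans _ cleT)// gerBl ltW.
have [|E _] := H1 _ chT; first by rewrite subKr gtr0_norm.
have H := H2 h _ ch0; rewrite h0 hr2 in H.
have {}H := ler_wpM2l c0_ge0 (H isT).
have ce : c0 * (e / 2 / (c0 + 1)) <= e / 2.
  by rewrite mulrCA ler_piMr ?(ltW e20)// ler_pdivrMr// mul1r lerDl.
apply: le_trans (lerD E H) _.
rewrite mulrDr addrACA lerD2l [leRHS]splitr lerD2l; exact: ce.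
Qed.

Lemma modified_energy_nonincreasing s t : 0 < s -> s <= t -> t <= T -> Phi t <= Phi s.
Proof.
move=> s0 st tT; apply: nonincreasing_of_dini => // c.
  move=> /andP[sc ct] e e0.
  have cT : 0 < c <= T by rewrite (lt_trans s0 sc) (le_trans ct tT).
  have [r r0 H] := modified_energy_left_lsc cT e0.
  by exists r => // h hr sch; apply: H => //; exact: lt_le_trans sch.
move=> /andP[sc ct] e e0; apply: modified_energy_dini => //.
by rewrite (lt_le_trans s0 sc) (lt_le_trans ct tT).
Qed.

Lemma history_pos_cvg0 : history_pos Omega alpha u s @[s --> 0^'+] --> (0 : R).
Proof.
have c : C ^+ 2 * s `^ alpha @[s --> 0^'+] --> (0 : R).
  by rewrite -[X in _ --> X](mulr0 (C ^+ 2)); apply: cvgMr; exact: powR_cvg0.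
apply: (squeeze_cvgr _ _ c); last exact: cvg_cst.
near=> s; rewrite history_pos_ge0//=.
apply: (history_pos_le mO alpha_gt0 C_ge0 Lu hoelder_u).
by apply/andP; split; near: s; [exact: nbhs_right_gt|exact: nbhs_right_le].
Unshelve. all: by end_near. Qed.

(** Monotonicity on positive times, and the limit at 0, where the energy is
    continuous and the history vanishes. *)
Lemma modified_energy_le_initial t : 0 < t <= T -> Phi t <= energy Omega eps u 0.
Proof.
move=> /andP[t0 tT]; apply/ler_addgt0Pr => e e0.
have zT : 0 <= (0 : R) <= T by rewrite lexx ltW.
have e20 : 0 < e / 2 by rewrite divr_gt0.
have [r1 r10 H1] := energy_continuous zT e20.
have [r2 r20 H2] := powR_small alpha_gt0 (mulr_ge0 c0_ge0 (sqr_ge0 C)) e20.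
pose s := Num.min t (Num.min r1 r2) / 2.
have m0 : 0 < Num.min t (Num.min r1 r2) by rewrite !lt_min t0 r10.
have s0 : 0 < s by rewrite divr_gt0.
have : s < Num.min t (Num.min r1 r2) by rewrite ltr_pdivrMr// ltr_pMr// ltr1n.
rewrite !lt_min => /and3P[st sr1 sr2].
have sT : s <= T by rewrite (le_trans (ltW st)).
apply: le_trans (modified_energy_nonincreasing s0 (ltW st) tT) _.
have [||_ E] := H1 s; first by rewrite (ltW s0).
  by rewrite sub0r normrN gtr0_norm.
have sT' : 0 < s <= T by rewrite s0.
have := history_pos_le mO alpha_gt0 C_ge0 Lu hoelder_u sT'.
move=> /(ler_wpM2l c0_ge0) H; rewrite mulrA in H.
have {}H := le_trans H (H2 s _); rewrite s0 sr2 in H.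
by apply: le_trans (lerD E (H isT)) _; rewrite -addrA -splitr.
Qed.

Lemma modified_energyE t : modified_energy Omega alpha gamma eps u t =
  if t == 0 then energy Omega eps u 0 else Phi t.
Proof.
rewrite /modified_energy /history; case: eqP => [->|_] //.
by rewrite (cvg_lim _ history_pos_cvg0)// mulr0 addr0.
Qed.

Lemma energy_dissipation s t : 0 <= s -> s <= t -> t <= T ->
  [/\ energy Omega eps u t <= modified_energy Omega alpha gamma eps u t,
      modified_energy Omega alpha gamma eps u t <=
        modified_energy Omega alpha gamma eps u s &
      modified_energy Omega alpha gamma eps u s <= energy Omega eps u 0].
Proof.
move=> s0 st tT.
have Phi_ge (r : R) : energy Omega eps u r <= Phi r.
  by rewrite /Phi lerDl mulr_ge0// history_pos_ge0.
have pos (r : R) : 0 <= r -> r != 0 -> 0 < r by move=> r0 rn; rewrite lt_neqAle eq_sym rn.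
rewrite !modified_energyE; split.
- by case: eqP => [->|_].
- case: eqP => [t0|/eqP tn]; case: eqP => [s0'|/eqP sn] //.
  + by move: st; rewrite t0 => /le_lt_trans/(_ (pos _ s0 sn)); rewrite ltxx.
  + by apply: modified_energy_le_initial; rewrite tT pos// (le_trans s0 st).
  + exact: modified_energy_nonincreasing (pos _ s0 sn) st tT.
- case: eqP => [|/eqP sn] //.
  by apply: modified_energy_le_initial; rewrite pos// (le_trans st tT).
Qed.

End allen_cahn.

Theorem theorem3p1 (R : realType) (d : nat) (d_gt0 : (0 < d)%N)
    (Omega : set 'rV[R]_d)
    (Omega_domain : bounded_domain Omega)
    (Omega_boundary : lipschitz_boundary Omega)
    (alpha gamma eps T : R)
    (alpha_gt0 : 0 < alpha) (alpha_lt1 : alpha < 1)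
    (gamma_gt0 : 0 < gamma) (eps_gt0 : 0 < eps) (T_gt0 : 0 < T)
    (u0 : 'rV[R]_d -> R) (u0_H2 : H2 Omega u0) (u0_H10 : H10 Omega u0)
    (u ut cu : R -> 'rV[R]_d -> R)
    (u_sol : allen_cahn_solution Omega alpha gamma eps T u0 u ut cu) :
  forall s t : R, 0 <= s -> s <= t -> t <= T ->
    [/\ energy Omega eps u t <= modified_energy Omega alpha gamma eps u t,
        modified_energy Omega alpha gamma eps u t <=
          modified_energy Omega alpha gamma eps u s &
        modified_energy Omega alpha gamma eps u s <= energy Omega eps u 0].
Proof.
case: Omega_domain => _ oO _ bO.
have mO : measurable Omega by exact: open_measurable_rV.
case: u_sol => der cap eqn _ _ _ Linf [Lu [C hol]] cH2 _ cut [K bound].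
have hoelder s t : 0 <= s <= T -> 0 <= t <= T ->
    L2dist Omega (u t) (u s) <= `|C| * `|t - s| `^ alpha.
  move=> sT tT; apply: le_trans (hol s t sT tT) _.
  by rewrite ler_wpM2r ?powR_ge0 ?ler_norm.
have ut_bound t : 0 < t <= T -> L2norm Omega (ut t) <= `|K| * t `^ (alpha - 1).
  move=> tT; apply: le_trans (bound t tT) _.
  by rewrite ler_wpM2r ?powR_ge0 ?ler_norm.
have [M M0 bounded] :=
  Linfty_all_times mO T_gt0 alpha_gt0 (normr_ge0 C) Lu hoelder Linf.
exact: (energy_dissipation mO bO alpha_gt0 alpha_lt1 gamma_gt0 T_gt0 (normr_ge0 C)
  (normr_ge0 K) M0 Lu hoelder der cut ut_bound bounded cH2 cap eqn).
Qed.
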